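(* Let $\{X_t,t\ge 0\}$ be a continuous-time Markov chain on a countable state space $I$ with honest, standard transition function $P(t,x,y)$, regular $Q$-matrix and almost surely infinite first flying time (all as described in the context), and let $x\in I$. Then for all sufficiently large $t>0$ the following estimates hold: (1) $\displaystyle 1-\frac1e\le \frac{S_t(x,x)}{G_{1/t}(x,x)}\le e.$ (2) $\displaystyle 1-\frac1e\le \frac{B_t(x,x)}{\int_0^\infty e^{-s/t}(1-F_{xx}(s))\,ds}\le e.$ (3) $\displaystyle \frac{1}{2q_x}\le \frac{G_{1/t}(x,x)\int_0^\infty e^{-s/t}(1-F_{xx}(s))\,ds}{t}\le \frac1{q_x}.$
   Context: $\{X_t,t\ge0\}$ is a continuous-time Markov chain on a countable state space $I$ with transition function $P(t,x,y)=P(X_t=y\mid X_0=x)$, which is honest ($\sum_{y\in I}P(t,x,y)=1$) and standard ($\lim_{t\downarrow0}P(t,x,y)=\delta_{xy}$). Its $Q$-matrix $q_{xy}=\lim_{t\downarrow 0}(P(t,x,y)-\delta_{xy})/t$ is regular: $0\le q_{xy}<\infty$ for $x\ne y$, $0<q_x:=-q_{xx}<\infty$, and $\sum_{y\in I}q_{xy}=0$. Let $\eta_1<\eta_2<\cdots$ be the successive jump times of the process; it is assumed that the first flying time $\eta=\lim_n\eta_n$ is almost surely infinite (the process is non-explosive), so the process is determined by $Q$. $P^x$ is the law of the process started at $x$. The first returning time of $x$ is $\tau_x=\inf\{t>\eta_1: X_t=x\}$ (with $\inf\emptyset=\infty$), and $F_{xx}(t)=P^x(\tau_x\le t)$. Further,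 $S_t(x,x)=\int_0^tP(s,x,x)\,ds$, $G_\alpha(x,x)=\int_0^\infty e^{-\alpha t}P(t,x,x)\,dt$ for $\alpha>0$, and $B_t(x,x)=\int_0^t(1-F_{xx}(s))\,ds$. *)

(* Defs.v *)
From HB Require Import structures.
From mathcomp Require Import all_boot all_order all_algebra.
From mathcomp Require Import all_classical all_reals all_analysis.

Set Implicit Arguments.
Unset Strict Implicit.
Unset Printing Implicit Defensive.

Import Order.TTheory GRing.Theory Num.Theory.
Import numFieldNormedType.Exports.

Local Open Scope classical_set_scope.
Local Open Scope ring_scope.

Section TransitionFunction.
Context {R : realType} {I : countType}.
Implicit Types (P : R -> I -> I -> R) (q : I -> I -> R).

(* Times are elements of R; only t >= 0 is ever constrained or used. *)
Record transition_function P : Prop := TransitionFunction {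
  transition_ge0 : forall (t : R) x y, 0 <= t -> 0 <= P t x y ;
  transition_le1 : forall (t : R) x, 0 <= t ->
    (\esum_(y in [set: I]) (P t x y)%:E <= 1)%E ;
  transition0 : forall x y, P 0 x y = (x == y)%:R ;
  transitionD : forall (s t : R) x z, 0 <= s -> 0 <= t ->
    ((P (s + t)%R x z)%:E = \esum_(y in [set: I]) (P s x y * P t y z)%R%:E)%E }.

Definition honest P : Prop := forall (t : R) x, 0 <= t ->
  (\esum_(y in [set: I]) (P t x y)%:E = 1)%E.

Definition standard P : Prop := forall x y,
  P t x y @[t --> 0^'+] --> ((x == y)%:R : R).

Definition is_Qmatrix P q : Prop := forall x y,
  (P t x y - (x == y)%:R) / t @[t --> 0^'+] --> q x y.

(* [esum] is only meaningful for nonnegative families, so a signed family is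
   summed as the difference of the sums of its positive and negative parts;
   the value is finite only if the family is absolutely summable. *)
Definition signed_sum (f : I -> R) : \bar R :=
  (\esum_(y in [set: I]) (EFin \o f)^\+ y -
   \esum_(y in [set: I]) (EFin \o f)^\- y)%E.

Definition exit_rate q (x : I) : R := - q x x.

(* Finiteness of the rates is built into q being real-valued. *)
Record regular_Qmatrix q : Prop := RegularQmatrix {
  Qmatrix_offdiag_ge0 : forall x y, x != y -> 0 <= q x y ;
  exit_rate_gt0 : forall x, 0 < exit_rate q x ;
  Qmatrix_conservative : forall x, signed_sum (q x) = 0%E }.

End TransitionFunction.

Section Process.
Context {R : realType} {d : measure_display} {Omega : measurableType d}
  {I : countType}.
Implicit Types (X : R -> Omega -> I) (Pr : I -> probability Omega R).

Definition history X (h : seq (R * I)) : set Omega :=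
  [set w | forall u, u \in h -> X u.1 w = u.2].

(* Pr x is the law of the process started at x.  The Markov property is the
   elementary one,
     P^x(X_{s+t} = z | X_s = y, X_{u_i} = y_i for all i) = P(t,y,z)
   for times u_i in [0, s], multiplied out so that conditioning events of
   probability zero need no special treatment.  Paths are right-continuous for
   the discrete topology of I, so that the jump times below make sense. *)
Record markov_chain Pr X (P : R -> I -> I -> R) : Prop := MarkovChain {
  chain_measurable : forall (t : R) y, 0 <= t -> measurable [set w | X t w = y] ;
  chain_right_continuous : forall w (t : R), 0 <= t ->
    \forall s \near t^'+, X s w = X t w ;
  chain_start : forall x, Pr x [set w | X 0 w = x] = 1%E ;
  chain_markov : forall x (h : seq (R * I)) (s t : R) (y z : I), 0 <= s -> 0 <= t ->
    (forall u, u \in h -> 0 <= u.1 <= s) ->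
    (Pr x (history X h `&` [set w | X s w = y] `&` [set w | X (s + t)%R w = z]) =
     Pr x (history X h `&` [set w | X s w = y]) * (P t y z)%:E)%E }.

(* jump_time X n w is eta_n, with eta_0 = 0; once it is +oo it remains so,
   since the set whose infimum is taken is then empty. *)
Fixpoint jump_time X (n : nat) (w : Omega) : \bar R :=
  if n is m.+1 then
    ereal_inf [set t%:E | t in
      [set t : R | (jump_time X m w < t%:E)%E /\
                   X t w <> X (fine (jump_time X m w)) w]]
  else 0%E.

Definition flying_time X (w : Omega) : \bar R :=
  limn (fun n => jump_time X n w).

Definition nonexplosive Pr X : Prop :=
  forall x, {ae Pr x, forall w, flying_time X w = +oo%E}.

Definition return_time X (x : I) (w : Omega) : \bar R :=
  ereal_inf [set t%:E | t in
    [set t : R | (jump_time X 1 w < t%:E)%E /\ X t w = x]].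

Definition return_cdf Pr X (x : I) (t : R) : R :=
  fine (Pr x [set w | (return_time X x w <= t%:E)%E]).

Definition truncated_return Pr X (t : R) (x : I) : R :=
  \int[lebesgue_measure]_(s in `[0, t]) (1 - return_cdf Pr X x s).

Definition laplace_return Pr X (a : R) (x : I) : R :=
  \int[lebesgue_measure]_(s in `[0, +oo[)
    (expR (- a * s) * (1 - return_cdf Pr X x s)).

End Process.

Section Green.
Context {R : realType} {I : countType}.
Implicit Type P : R -> I -> I -> R.

Definition occupation P (t : R) (x : I) : R :=
  \int[lebesgue_measure]_(s in `[0, t]) P s x x.

Definition green P (a : R) (x : I) : R :=
  \int[lebesgue_measure]_(t in `[0, +oo[) (expR (- a * t) * P t x x).

End Green.

(* Main.v *)
(** Everything is reduced to the skeletons [X_{kh}] and the limit [h -> 0].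
    For a skeleton put [p = P h x x], [u_k = P (k h) x x], let [v_k] be the
    probability of avoiding [x] during steps [1..k] and [w_k] that of not coming
    back to [x] after an exit during steps [0..k].  Decomposing at the last visit
    gives [sum_{k <= n} u_k v_{n-k} = 1], and [w_{k+1} = p w_k + v_{k+1}], so the
    generating functions satisfy [U W (1 - z) (1 - p z) = 1].  At
    [z = exp (- a h)], [h -> 0] turns this into
    [a G_a L_a (a + q_x) = 1], where [G_a] is the resolvent and [L_a] the Laplace
    transform of [1 - F_xx]; at [a = 1/t] this is (3) as soon as [t >= 1/q_x].
    Estimates (1) and (2) hold for every [t > 0]: the window [mt, (m+1)t] has
    weight at most [exp (- m)] in the Laplace transform, and contributes no more
    to the integral than the window [0, t], because [1 - F_xx] is nonincreasing,
    and because the skeleton started anywhere visits [x] in [N] steps on average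
    at most as often as when started at [x]. *)
Require Import Defs.
From HB Require Import structures.
From mathcomp Require Import all_boot all_order all_algebra.
From mathcomp Require Import all_classical all_reals all_analysis.
From mathcomp Require Import measurable_realfun ring lra.
Import Order.TTheory GRing.Theory Num.Theory.
Import numFieldNormedType.Exports.
Local Open Scope classical_set_scope.
Local Open Scope ring_scope.

Set Implicit Arguments.
Unset Strict Implicit.
Unset Printing Implicit Defensive.

(** * Last visit decomposition for a stochastic matrix *)

(** Sums over [I] become series along the enumeration [pickle_inv], codes of no element contributing
    0, so that results on nonnegative series can be used for them. *)
Lemma esum_countE (R : realType) (I : countType) (a : I -> \bar R) :
  (forall y, 0 <= a y)%E ->
  \esum_(y in [set: I]) a y = (\sum_(n <oo) oapp a 0 (pickle_inv n))%E.
Proof.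
move=> a0; rewrite nneseries_esumT; last by move=> n; case: pickle_inv.
transitivity (\esum_(n in range (@pickle I)) oapp a 0%E (pickle_inv n)).
  rewrite (@reindex_esum _ _ _ [set: I] _ (@pickle I)).
    by apply: eq_esum => y _; rewrite pickleK_inv.
  by split=> // y z _ _; exact: (pcan_inj (@pickleK_inv I)).
rewrite esum_mkcond; apply: eq_esum => n _; case: ifPn => // nI.
case E : (pickle_inv n) => [y|]//=; exfalso; move/negP: nI; apply.
rewrite inE; exists y => //.
by have := @pickle_invK I n; rewrite /ocancel E.
Qed.

Lemma esumZl (R : realType) (I : countType) (c : R) (a : I -> \bar R) :
  0 <= c -> (forall y, 0 <= a y)%E ->
  \esum_(y in [set: I]) (c%:E * a y)%E = (c%:E * \esum_(y in [set: I]) a y)%E.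
Proof.
move=> c0 a0; rewrite !esum_countE//; last by move=> y; rewrite mule_ge0.
rewrite -nneseriesZl; last by move=> n _; case: pickle_inv.
by apply: eq_eseriesr => n _; case: pickle_inv => [y|]//=; rewrite mule0.
Qed.

Lemma esum_delta (R : realType) (I : countType) (x : I) (a : I -> R) :
  0 <= a x ->
  \esum_(y in [set: I]) ((y == x)%:R * a y)%:E = (a x)%:E.
Proof.
move=> a0; have <- : \esum_(i in [set x]) (a i)%:E = (a x)%:E by rewrite esum_set1.
rewrite [RHS]esum_mkcond; apply: eq_esum => y _.
case: ifPn => [|/negP]; rewrite inE/=; first by move=> ->; rewrite eqxx mul1r.
by move=> /eqP/negPf ->; rewrite mul0r.
Qed.

Definition stochastic (R : realType) (I : countType) (p : I -> I -> R) :=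
  (forall y z, 0 <= p y z) /\
  (forall y, \esum_(z in [set: I]) (p y z)%:E = 1%E).

(** Probability that the chain with one-step matrix [p] started at [y] misses [x] at steps 1 to [n].
    The starting point is not tested, so [y = x] is meaningful. [fine] keeps the values real;
    [avoid_spec] shows that it loses nothing when [p] is stochastic. *)
Definition avoid (R : realType) (I : countType) (p : I -> I -> R) (x : I) :=
  fix avoid n y : R := if n is m.+1 then
    fine (\esum_(z in [set: I]) (p y z * ((z != x)%:R * avoid m z))%:E)
  else 1.

Lemma stochastic_mean_le (R : realType) (I : countType) (p : I -> I -> R)
    (y : I) (g : I -> R) (c : R) : stochastic p ->
  0 <= c -> (forall z, g z <= c) ->
  (\esum_(z in [set: I]) (p y z * g z)%:E <= c%:E)%E.
Proof.
move=> [p0 p1] c0 gc.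
apply: (@le_trans _ _ (\esum_(z in [set: I]) (c%:E * (p y z)%:E)%E)).
  by apply: le_esum => z _; rewrite -EFinM lee_fin mulrC ler_wpM2r.
by rewrite esumZl// ?p1 ?mule1// => z; rewrite lee_fin.
Qed.

(** Bounds and recursion are proved together: the bounds at level [n] make the sum defining level
    [n.+1] finite, which is what allows [fine] to be undone. *)
Lemma avoid_spec (R : realType) (I : countType) (p : I -> I -> R) (x : I) n y :
  stochastic p -> 0 <= avoid p x n y <= 1 /\
  (avoid p x n.+1 y)%:E =
    \esum_(z in [set: I]) (p y z * ((z != x)%:R * avoid p x n z))%:E.
Proof.
move=> sp; have [p0 p1] := sp.
have step m : (forall z, 0 <= avoid p x m z <= 1) -> forall z,
    0 <= avoid p x m.+1 z <= 1 /\ (avoid p x m.+1 z)%:E =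
    \esum_(z' in [set: I]) (p z z' * ((z' != x)%:R * avoid p x m z'))%:E.
  move=> h z; set s := \esum_(_ in _) _.
  have s0 : (0 <= s)%E.
    apply: esum_ge0 => z' _; rewrite lee_fin !mulr_ge0//.
    by have /andP[] := h z'.
  have s1 : (s <= 1)%E.
    apply: stochastic_mean_le => // z'.
    have /andP[h0 h1] := h z'; by case: (z' != x); rewrite /= ?mul1r ?mul0r.
  have fs : s \is a fin_num by rewrite ge0_fin_numE// (le_lt_trans s1) ?ltry.
  have -> : avoid p x m.+1 z = fine s by [].
  by rewrite fineK// fine_ge0//= -lee_fin fineK.
have b m : forall z, 0 <= avoid p x m z <= 1.
  by elim: m => [z|m /step ih z]; [rewrite /= ler01 lexx|have [] := ih z].
by split=> //; have [] := step n (b n) y.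
Qed.

Lemma avoid_ge0 (R : realType) (I : countType) (p : I -> I -> R) (x : I) n y :
  stochastic p -> 0 <= avoid p x n y.
Proof. by move=> sp; have [/andP[]] := avoid_spec x n y sp. Qed.

Lemma avoid_le1 (R : realType) (I : countType) (p : I -> I -> R) (x : I) n y :
  stochastic p -> avoid p x n y <= 1.
Proof. by move=> sp; have [/andP[]] := avoid_spec x n y sp. Qed.

Lemma avoidS (R : realType) (I : countType) (p : I -> I -> R) (x : I) n y :
  stochastic p -> (avoid p x n.+1 y)%:E =
    \esum_(z in [set: I]) (p y z * ((z != x)%:R * avoid p x n z))%:E.
Proof. by move=> sp; have [] := avoid_spec x n y sp. Qed.

(* [u k y] plays the role of the [k]-step probability from [y] to [x]. *)
Definition visits (R : realType) (I : countType) (p : I -> I -> R) (x : I)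
    (u : nat -> I -> R) :=
  [/\ forall k y, 0 <= u k y, forall y, u 0%N y = (y == x)%:R &
   forall k y, (u k.+1 y)%:E = \esum_(z in [set: I]) (p y z * u k z)%:E].

(** Paths of [N] steps are split by their last visit to [x] at a step [k.+1], after which [x] is
    avoided for the remaining steps; the final term counts the paths with no visit. The induction
    conditions on the first step, hence the arbitrary start [y]. *)
Lemma last_visit (R : realType) (I : countType) (p : I -> I -> R) (x : I)
    (u : nat -> I -> R) (N : nat) (y : I) :
  stochastic p -> visits p x u ->
  \sum_(k < N) u k.+1 y * avoid p x (N - k.+1) x + avoid p x N y = 1.
Proof.
move=> sp [u0 u00 uS]; have [p0 p1] := sp.
elim: N y => [y|N ih y]; first by rewrite big_ord0 add0r.
rewrite big_ord_recl /= subn1 /=; apply: EFin_inj; rewrite !EFinD avoidS//.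
rewrite EFinM uS.
have -> : (\esum_(z in [set: I]) (p y z * u 0%N z)%:E = (p y x)%:E)%E.
  rewrite -(@esum_delta _ _ x (p y))//; apply: eq_esum => z _.
  by rewrite u00 mulrC.
have -> : ((\sum_(i < N) u (bump 0 i).+1 y * avoid p x (N.+1 - (bump 0 i).+1) x)%:E
    = \esum_(z in [set: I])
       (p y z * \sum_(i < N) u i.+1 z * avoid p x (N - i.+1) x)%:E)%E.
  rewrite -sumEFin; under [RHS]eq_esum => z _ do rewrite mulr_sumr -sumEFin.
  rewrite esum_sum; last first.
    by move=> z i _ _; rewrite lee_fin !mulr_ge0// avoid_ge0.
  apply: eq_bigr => i _; rewrite /bump leq0n add1n subSS EFinM uS muleC.
  rewrite -esumZl ?avoid_ge0//; last by move=> z; rewrite lee_fin mulr_ge0.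
  by apply: eq_esum => z _; rewrite -EFinM; congr EFin; ring.
rewrite -EFinM.
rewrite -(@esum_delta _ _ x (fun z => p y z * avoid p x N z)); last first.
  by rewrite mulr_ge0// avoid_ge0.
have s0 z : 0 <= \sum_(i < N) u i.+1 z * avoid p x (N - i.+1) x.
  by apply: sumr_ge0 => i _; rewrite mulr_ge0// avoid_ge0.
rewrite -!esumD//; last 4 first.
- by move=> z _; rewrite -EFinD lee_fin addr_ge0// !mulr_ge0// avoid_ge0.
- by move=> z _; rewrite lee_fin !mulr_ge0// avoid_ge0.
- by move=> z _; rewrite lee_fin !mulr_ge0// avoid_ge0.
- by move=> z _; rewrite lee_fin mulr_ge0.
rewrite -[RHS](p1 y); apply: eq_esum => z _; rewrite -!EFinD; congr EFin.
(* The term [avoid p x N z] of the induction hypothesis comes from the visit at step 1 if [z = x],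
   and from the no-visit term otherwise. *)
rewrite -[RHS]mulr1 -[in RHS](ih z).
by case: (z == x) => /=; ring.
Qed.

(** When the start is [x], the no-visit term of [last_visit] becomes the case of a last visit at
    time 0. *)
Lemma renewal (R : realType) (I : countType) (p : I -> I -> R) (x : I)
    (u : nat -> I -> R) (N : nat) :
  stochastic p -> visits p x u ->
  \sum_(k < N.+1) u k x * avoid p x (N - k) x = 1.
Proof.
move=> sp vu; rewrite big_ord_recl /= subn0 addrC -(last_visit N x sp vu).
by have [_ -> _] := vu; rewrite eqxx mul1r.
Qed.

(** Started away from [x], the chain scores nothing at time 0. The visits at the later steps are an
    average, over the state after one step, of visit counts with one step fewer, to which the
    induction hypothesis applies. *)
Lemma visits_le (R : realType) (I : countType) (p : I -> I -> R) (x : I)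
    (u : nat -> I -> R) (N : nat) (y : I) :
  stochastic p -> visits p x u ->
  \sum_(k < N) u k y <= \sum_(k < N) u k x.
Proof.
move=> sp [u0 u00 uS]; have [p0 p1] := sp.
elim: N y => [y|N ih y]; first by rewrite !big_ord0.
have [->//|yx] := eqVneq y x.
rewrite big_ord_recl u00 (negPf yx) add0r big_ord_recr /=.
suff h : \sum_(i < N) u (bump 0 i) y <= \sum_(i < N) u i x.
  by rewrite (le_trans h)// lerDl.
rewrite -lee_fin -sumEFin; under eq_bigr => i _ do rewrite uS.
rewrite -esum_sum; last by move=> z i _ _; rewrite lee_fin mulr_ge0.
rewrite (eq_esum (b := fun z => (p y z * \sum_(i < N) u i z)%:E)); last first.
  by move=> z _; rewrite sumEFin mulr_sumr.
by apply: stochastic_mean_le => //; exact: sumr_ge0.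
Qed.

(** * Generating functions *)

Definition gsum (R : realType) (z : R) (c : nat -> R) : \bar R :=
  (\sum_(k <oo) (z ^+ k * c k)%:E)%E.

Lemma gsum_ge0 (R : realType) (z : R) (c : nat -> R) :
  0 <= z -> (forall k, 0 <= c k) -> (0 <= gsum z c)%E.
Proof.
move=> z0 c0; apply: nneseries_ge0 => k _ _.
by rewrite lee_fin mulr_ge0// exprn_ge0.
Qed.

Lemma gsum1 (R : realType) (z : R) :
  0 <= z < 1 -> gsum z (fun=> 1) = ((1 - z)^-1)%:E.
Proof.
move=> /andP[z0 z1]; apply/cvg_lim => //.
have -> : (fun n => (\sum_(0 <= k < n) (z ^+ k * 1)%:E)%E) =
    EFin \o series (geometric 1 z).
  apply/funext => n /=; rewrite /series/= sumEFin; congr EFin.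
  by apply: eq_bigr => i _; rewrite mulrC.
apply: cvg_EFin; first by apply: nearW.
rewrite -[(1 - z)^-1]mul1r; apply: cvg_geometric_series.
by rewrite ger0_norm.
Qed.

Lemma le_gsum (R : realType) (z : R) (a b : nat -> R) :
  0 <= z -> (forall k, 0 <= a k <= b k) -> (gsum z a <= gsum z b)%E.
Proof.
move=> z0 ab; apply: lee_nneseries => [k _ _|k _]; have /andP[a0 le] := ab k.
  by rewrite lee_fin mulr_ge0// exprn_ge0.
by rewrite lee_fin ler_wpM2l// exprn_ge0.
Qed.

Lemma gsum_fin_num (R : realType) (z : R) (c : nat -> R) :
  0 <= z < 1 -> (forall k, 0 <= c k <= 1) -> gsum z c \is a fin_num.
Proof.
move=> /[dup] zz /andP[z0 z1] c01; rewrite ge0_fin_numE; last first.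
  by apply: gsum_ge0 => // k; have /andP[] := c01 k.
apply: (@le_lt_trans _ _ (gsum z (fun=> 1))); first exact: le_gsum.
by rewrite gsum1// ltry.
Qed.

Lemma gsum_recl (R : realType) (z : R) (c : nat -> R) :
  0 <= z -> (forall k, 0 <= c k) ->
  gsum z c = ((c 0%N)%:E + z%:E * gsum z (fun k => c k.+1))%E.
Proof.
move=> z0 c0; have zc k : 0 <= z ^+ k * c k by rewrite mulr_ge0// exprn_ge0.
rewrite /gsum nneseries_recl//; last by move=> k _; rewrite lee_fin.
rewrite expr0 mul1r; congr (_ + _)%E.
rewrite -(nneseries_addn (f := fun k => (z ^+ k * c k)%:E)); last first.
  by move=> k; rewrite lee_fin.
rewrite -nneseriesZl; last first.
  by move=> k _; rewrite lee_fin mulr_ge0// exprn_ge0.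
by apply: eq_eseriesr => k _; rewrite addn1 exprS -mulrA EFinM.
Qed.

(** Cauchy product by interchanging the double series of the array [f], which extends the terms by 0
    to [n < k]. Finiteness of the second factor lets it be pulled out as a real constant. *)
Lemma nneseries_convolution (R : realType) (a b : nat -> R) :
  (forall k, 0 <= a k) -> (forall k, 0 <= b k) ->
  (\sum_(k <oo) (b k)%:E \is a fin_num)%E ->
  (\sum_(n <oo) (\sum_(k < n.+1) a k * b (n - k)%N)%:E =
   (\sum_(k <oo) (a k)%:E) * (\sum_(k <oo) (b k)%:E))%E.
Proof.
move=> a0 b0 fb; set B := (\sum_(k <oo) (b k)%:E)%E in fb *.
pose f k n : \bar R := if (k <= n)%N then (a k * b (n - k)%N)%:E else 0%E.
have f0 k n : (0 <= f k n)%E.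
  by rewrite /f; case: ifP => // _; rewrite lee_fin mulr_ge0.
transitivity (\sum_(n <oo) \sum_(k <oo) f k n)%E.
  apply: eq_eseriesr => n _.
  rewrite (nneseries_split 0%N n.+1)// [X in (_ + X)%E]eseries0 => [|k]; last first.
    by rewrite add0n /f => nk _; rewrite leqNgt nk.
  rewrite adde0 add0n big_mkord -sumEFin; apply: eq_bigr => k _.
  by rewrite /f -ltnS ltn_ord.
rewrite nneseries_interchange// muleC -(fineK fb) -nneseriesZl; last first.
  by move=> k _; rewrite lee_fin.
apply: eq_eseriesr => k _; rewrite (fineK fb) muleC -nneseriesZl; last first.
  by move=> n _; rewrite lee_fin.
rewrite (nneseries_split 0%N k)// add0n big1_seq ?add0e; last first.
  by move=> n /andP[_]; rewrite mem_index_iota /f => /andP[_ nk]; rewrite leqNgt nk.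
rewrite -nneseries_addn//; apply: eq_eseriesr => n _.
by rewrite /f leq_addl addnK EFinM.
Qed.

(** The renewal equation gives [U V = 1 / (1 - z)] and the recurrence for [w] gives
    [W (1 - p z) = V]; eliminating [V] yields the claim. [W] is written as [1 + z W'], with [W'] the
    series of the shifted sequence, because the shifted waiting probabilities are those whose limit
    is taken in [cvg_wait]. *)
Lemma renewal_gsum (R : realType) (z p : R) (u v w : nat -> R) :
  0 <= z < 1 -> 0 <= p ->
  (forall k, 0 <= u k <= 1) -> (forall k, 0 <= v k <= 1) ->
  (forall k, 0 <= w k <= 1) ->
  (forall n, \sum_(k < n.+1) u k * v (n - k)%N = 1) ->
  v 0%N = 1 -> w 0%N = 1 -> (forall k, w k.+1 = p * w k + v k.+1) ->
  fine (gsum z u) * (1 + z * fine (gsum z (fun k => w k.+1))) *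
    ((1 - z) * (1 - p * z)) = 1.
Proof.
move=> /[dup] zz /andP[z0 z1] p0 u01 v01 w01 uv v0 w0 wS.
have ge (c : nat -> R) : (forall k, 0 <= c k <= 1) -> forall k, 0 <= c k.
  by move=> h k; have /andP[] := h k.
have zc k (c : nat -> R) : (forall k, 0 <= c k <= 1) -> 0 <= z ^+ k * c k.
  by move=> h; rewrite mulr_ge0 ?exprn_ge0// ge.
have UV : (gsum z u * gsum z v = ((1 - z)^-1)%:E)%E.
  rewrite -gsum1// -nneseries_convolution; last 3 first.
  - by move=> k; exact: zc.
  - by move=> k; exact: zc.
  - exact: gsum_fin_num.
  apply: eq_eseriesr => n _; congr EFin; rewrite -(uv n) mulr_sumr.
  apply: eq_bigr => k _; rewrite mulrACA -exprD subnKC//.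
  by rewrite -ltnS ltn_ord.
have WS : (gsum z (fun k => w k.+1) =
    p%:E * gsum z w + gsum z (fun k => v k.+1))%E.
  rewrite /gsum -nneseriesZl; last by move=> k _; rewrite lee_fin zc.
  rewrite -nneseriesD; last 2 first.
  - by move=> k _ _; rewrite -EFinM lee_fin mulr_ge0// zc.
  - by move=> k _ _; rewrite lee_fin (zc _ (fun k => v k.+1)).
  by apply: eq_eseriesr => k _; rewrite -EFinM -EFinD wS; congr EFin; ring.
have Vr := gsum_recl z0 (ge _ v01).
have Wr := gsum_recl z0 (ge _ w01).
have fin c : (forall k, 0 <= c k <= 1) -> gsum z c = (fine (gsum z c))%:E.
  by move=> h; rewrite fineK// gsum_fin_num.
move: UV WS Vr Wr; rewrite v0 w0 (fin u)// (fin v)// (fin w)//.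
rewrite (fin (fun k => v k.+1))// (fin (fun k => w k.+1))//.
set U := fine (gsum z u); set V := fine (gsum z v); set W := fine (gsum z w).
set W' := fine _; set V' := fine _.
rewrite -!EFinM -!EFinD => -[UV] [WS] [Vr] [Wr] /=.
have z1' : 1 - z != 0 by rewrite subr_eq0 gt_eqF.
have E : (1 + z * W') * (1 - p * z) = V.
  have -> : V = 1 + z * (W' - p * W) by rewrite Vr WS; ring.
  by rewrite -Wr mulrBr mulr1 {1}Wr; ring.
rewrite [(1 - z) * _]mulrC mulrA -[U * _ * _]mulrA E UV.
by rewrite mulVf.
Qed.

(** * Avoiding and waiting probabilities of a skeleton *)

Lemma measure_fiber (d : measure_display) (T : measurableType d)
    (R : realType) (I : countType) (mu : {measure set T -> \bar R})
    (f : T -> I) (A : set T) :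
  measurable A -> (forall y, measurable [set w | f w = y]) ->
  mu A = \esum_(y in [set: I]) mu (A `&` [set w | f w = y]).
Proof.
move=> mA mf; rewrite esum_countE//.
pose F n := if pickle_inv n is Some y then A `&` [set w | f w = y] else set0.
have mF n : measurable (F n).
  by rewrite /F; case: pickle_inv => // y; exact: measurableI.
transitivity (mu (\bigcup_n F n)).
  congr (mu _); apply/seteqP; split=> w.
    by move=> Aw; exists (pickle (f w)) => //; rewrite /F pickleK_inv.
  by case=> n _; rewrite /F; case: pickle_inv => //= y [].
rewrite measure_semi_bigcup//; last 2 first.
- move=> m n _ _ [w []]; rewrite /F.
  case Em : (pickle_inv m) => [y|//]; case En : (pickle_inv n) => [y'|//] /=.
  move=> [_ yw] [_ yw'].
  have := @pickle_invK I m; have := @pickle_invK I n.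
  by rewrite /ocancel Em En /= -yw -yw' => <- <-.
- exact: bigcupT_measurable.
apply: eq_eseriesr => n _; rewrite /F; case: pickle_inv => //=.
Qed.

Lemma probability_full_setI (d : measure_display) (T : measurableType d)
    (R : realType) (Q : probability T R) (S A : set T) :
  measurable S -> measurable A -> Q S = 1%E -> Q (S `&` A) = Q A.
Proof.
move=> mS mA QS; have S0 : Q (~` S) = 0%E by rewrite probability_setC// QS subee.
rewrite (measureDI _ mA mS) setIC.
rewrite [X in _ = (X + _)%E](_ : _ = 0%E) ?add0e//.
apply: subset_measure0 S0; [exact: measurableD|exact: measurableC|by move=> w []].
Qed.

(** The recursion moves the starting time, as conditioning on the next grid point does, and thus
    parallels [avoid]; time [s] itself is not tested. *)
Fixpoint grid_avoid (R : realType) (Omega : Type) (I : countType)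
    (X : R -> Omega -> I) (h : R) (x : I) (n : nat) (s : R) : set Omega :=
  if n is m.+1 then
    [set w | X (s + h) w <> x] `&` grid_avoid X h x m (s + h)
  else setT.

(* Within [n] steps of the grid of mesh [h] started at [s], the path does not
   come back to [x] after having left it. *)
Fixpoint grid_wait (R : realType) (Omega : Type) (I : countType)
    (X : R -> Omega -> I) (h : R) (x : I) (n : nat) (s : R) : set Omega :=
  if n is m.+1 then
    ([set w | X (s + h) w = x] `&` grid_wait X h x m (s + h)) `|`
    grid_avoid X h x m.+1 s
  else setT.

(** First-step analysis of the event [grid_wait]: either the chain is at [x] after one step and the
    wait starts afresh, or it has left and must avoid [x] at every step. *)
Fixpoint wait (R : realType) (I : countType) (p : I -> I -> R) (x : I)
    (n : nat) : R :=
  if n is m.+1 then p x x * wait p x m + avoid p x m.+1 x else 1.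

Lemma measurable_history (R : realType) (d : measure_display)
    (Omega : measurableType d) (I : countType)
    (X : R -> Omega -> I) (s : R) (h : seq (R * I)) :
  (forall (t : R) y, 0 <= t -> measurable [set w | X t w = y]) ->
  (forall u, u \in h -> 0 <= u.1 <= s) -> measurable (history X h).
Proof.
move=> mX; elim: h => [_|u h ih hs].
  rewrite (_ : history X [::] = setT)//.
  by apply/seteqP; split=> w // _ u; rewrite in_nil.
rewrite (_ : history X _ = [set w | X u.1 w = u.2] `&` history X h).
  apply: measurableI; last by apply: ih => v vh; rewrite hs// inE vh orbT.
  by apply: mX; have /andP[] := hs u (mem_head _ _).
apply/seteqP; split=> w /=.
  move=> H; split; first exact/H/mem_head.
  by move=> v vh; apply: H; rewrite inE vh orbT.
by case=> H1 H2 v; rewrite inE => /predU1P[->//|]; exact: H2.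
Qed.

Lemma history_cons (R : realType) (d : measure_display)
    (Omega : measurableType d) (I : countType)
    (X : R -> Omega -> I) (h : seq (R * I)) (s : R) (y : I) :
  history X ((s, y) :: h) = history X h `&` [set w | X s w = y].
Proof.
apply/seteqP; split=> w /=.
  move=> H; split; last exact: (H (s, y) (mem_head _ _)).
  by move=> v vh; apply: H; rewrite inE vh orbT.
by case=> H1 H2 v; rewrite inE => /predU1P[->//|]; exact: H1.
Qed.

Lemma measurable_grid_avoid (R : realType) (d : measure_display)
    (Omega : measurableType d) (I : countType)
    (X : R -> Omega -> I) (h : R) (x : I) (n : nat) (s : R) :
  (forall (t : R) y, 0 <= t -> measurable [set w | X t w = y]) ->
  0 <= h -> 0 <= s -> measurable (grid_avoid X h x n s).
Proof.
move=> mX h0; elim: n s => [|n ih] s s0; first exact: measurableT.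
apply: measurableI.
  by apply: measurableC; apply: mX; exact: addr_ge0.
by apply: ih; exact: addr_ge0.
Qed.

Lemma measurable_grid_wait (R : realType) (d : measure_display)
    (Omega : measurableType d) (I : countType)
    (X : R -> Omega -> I) (h : R) (x : I) (n : nat) (s : R) :
  (forall (t : R) y, 0 <= t -> measurable [set w | X t w = y]) ->
  0 <= h -> 0 <= s -> measurable (grid_wait X h x n s).
Proof.
move=> mX h0; elim: n s => [|n ih] s s0; first exact: measurableT.
apply: measurableU; last exact: (@measurable_grid_avoid _ _ _ _ _ _ _ n.+1).
by apply: measurableI; [apply: mX|apply: ih]; exact: addr_ge0.
Qed.

Lemma stochastic_transition (R : realType) (I : countType)
    (P : R -> I -> I -> R) (h : R) :
  transition_function P -> honest P -> 0 <= h -> stochastic (P h).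
Proof.
by move=> PP hP h0; split=> [y z|y]; [exact: transition_ge0|exact: hP].
Qed.

(** The event is split by the state [z] at time [s + h]. The Markov property handles this step, and
    the induction hypothesis is applied with [(s, y)] appended to the history, which is why the
    history is arbitrary. *)
Lemma prob_grid_avoid (R : realType) (d : measure_display)
    (Omega : measurableType d) (I : countType)
    (Pr : I -> probability Omega R) (X : R -> Omega -> I)
    (P : R -> I -> I -> R) (h : R) (x0 x : I) :
  markov_chain Pr X P -> 0 <= h -> stochastic (P h) ->
  forall n hs s y, 0 <= s -> (forall u, u \in hs -> 0 <= u.1 <= s) ->
  (Pr x0 (history X hs `&` [set w | X s w = y] `&` grid_avoid X h x n s) =
   Pr x0 (history X hs `&` [set w | X s w = y]) * (avoid (P h) x n y)%:E)%E.
Proof.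
move=> mc h0 sp; have mX := chain_measurable mc; have [p0 p1] := sp.
elim=> [|n ih] hs s y s0 hss; first by rewrite setIT mule1.
have sh0 : 0 <= s + h by exact: addr_ge0.
have mH := measurable_history mX hss.
have mHy : measurable (history X hs `&` [set w | X s w = y]).
  exact: measurableI (mX _ _ s0).
rewrite (measure_fiber (Pr x0) (f := X (s + h)))//; last 2 first.
- apply: measurableI => //.
  exact: (@measurable_grid_avoid _ _ _ _ _ _ _ n.+1).
- by move=> z; exact: mX.
have fin : Pr x0 (history X hs `&` [set w | X s w = y]) \is a fin_num.
  exact: fin_num_measure.
rewrite avoidS// -(fineK fin) -esumZl ?fine_ge0//; last first.
  by move=> z; rewrite lee_fin !mulr_ge0// avoid_ge0.
apply: eq_esum => z _; rewrite fineK//; have [->|zx] := eqVneq z x.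
  rewrite mul0r mulr0 mule0 (_ : _ `&` _ = set0) ?measure0//.
  by rewrite -subset0 => w [[_ [/= + _]]] /=.
rewrite mul1r EFinM muleA -chain_markov//.
have := ih ((s, y) :: hs) (s + h) z sh0.
rewrite history_cons => <-; last first.
  move=> u; rewrite inE => /predU1P[->/=|/hss/andP[-> us]].
    by rewrite s0 lerDl.
  by rewrite (le_trans us)// lerDl.
congr (Pr x0 _); apply/seteqP; split=> w /=; first by move=> [[? []]].
by move=> [[? /[dup] XZ ->]]; do !split=> //; exact/eqP.
Qed.

(** Same induction as for [prob_grid_avoid]; the two branches of [grid_wait] are disjoint, since
    they disagree on whether the path is at [x] at time [s + h]. *)
Lemma prob_grid_wait (R : realType) (d : measure_display)
    (Omega : measurableType d) (I : countType)
    (Pr : I -> probability Omega R) (X : R -> Omega -> I)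
    (P : R -> I -> I -> R) (h : R) (x0 x : I) :
  markov_chain Pr X P -> 0 <= h -> stochastic (P h) ->
  forall n hs s, 0 <= s -> (forall u, u \in hs -> 0 <= u.1 <= s) ->
  (Pr x0 (history X hs `&` [set w | X s w = x] `&` grid_wait X h x n s) =
   Pr x0 (history X hs `&` [set w | X s w = x]) * (wait (P h) x n)%:E)%E.
Proof.
move=> mc h0 sp; have mX := chain_measurable mc.
elim=> [|n ih] hs s s0 hss; first by rewrite setIT mule1.
have sh0 : 0 <= s + h by exact: addr_ge0.
have mH := measurable_history mX hss.
have mHy : measurable (history X hs `&` [set w | X s w = x]).
  exact: measurableI (mX _ _ s0).
have fin : Pr x0 (history X hs `&` [set w | X s w = x]) \is a fin_num.
  exact: fin_num_measure.
set A := _ `&` [set w | X s w = x].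
pose B := A `&` ([set w | X (s + h) w = x] `&` grid_wait X h x n (s + h)).
pose C := A `&` grid_avoid X h x n.+1 s.
transitivity (Pr x0 B + Pr x0 C)%E.
  rewrite -[grid_wait X h x n.+1 s]/(_ `|` _) setIUr; apply: measureU.
  - apply: measurableI => //; apply: measurableI; first exact: mX.
    exact: measurable_grid_wait.
  - by apply: measurableI => //; exact: measurable_grid_avoid.
  - by rewrite -subset0 => w [[_ [/= -> _]] [_ [/= + _]]].
rewrite /C (prob_grid_avoid _ _ mc)// -[wait _ _ n.+1]/(_ * _ + _) EFinD muleDr//.
congr (_ + _)%E; rewrite /B EFinM muleA -(chain_markov mc)//.
have := ih ((s, x) :: hs) (s + h) sh0.
rewrite history_cons setIA => <- // u.
rewrite inE => /predU1P[->/=|/hss/andP[-> us]]; first by rewrite s0 lerDl.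
by rewrite (le_trans us)// lerDl.
Qed.

Lemma prob_grid_wait0 (R : realType) (d : measure_display)
    (Omega : measurableType d) (I : countType)
    (Pr : I -> probability Omega R) (X : R -> Omega -> I)
    (P : R -> I -> I -> R) (h : R) (x : I) (n : nat) :
  markov_chain Pr X P -> 0 <= h -> stochastic (P h) ->
  (Pr x (grid_wait X h x n 0) = (wait (P h) x n)%:E)%E.
Proof.
move=> mc h0 sp; have mX := chain_measurable mc.
rewrite -(probability_full_setI _ _ (chain_start mc x)); last 2 first.
- exact: mX.
- exact: measurable_grid_wait.
have H0 : history X [::] = setT.
  by apply/seteqP; split=> w // _ u; rewrite in_nil.
have /= := @prob_grid_wait _ _ _ _ _ _ _ h x x mc h0 sp n [::] 0 (lexx 0).
by rewrite H0 setTI (chain_start mc) mul1e => ->.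
Qed.

(** * The return time along a grid *)

Lemma right_continuous_interval (R : realType) (I : Type) (f : R -> I) (t : R) :
  (\forall s \near t^'+, f s = f t) ->
  exists2 e : R, 0 < e & forall s, t <= s < t + e -> f s = f t.
Proof.
case=> e /= e0 H; exists e => // s /andP[]; rewrite le_eqVlt.
case/predU1P => [->//|ts st]; apply: H => //=.
by rewrite ltr0_norm ?subr_lt0// opprB ltrBlDl.
Qed.

Lemma jump_time1_lt (R : realType) (d : measure_display)
    (Omega : measurableType d) (I : countType)
    (X : R -> Omega -> I) (w : Omega) (t : R) :
  (jump_time X 1 w < t%:E)%E <-> exists r, [/\ 0 < r, r < t & X r w <> X 0 w].
Proof.
split=> [|[r [r0 rt Xr]]].
  by move/ereal_inf_lt => [_ [r [/= r0 Xr] <-]] rt; exists r.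
apply: (@le_lt_trans _ _ r%:E); last by rewrite lte_fin.
by apply: ereal_inf_lbound; exists r => //=; split.
Qed.

Lemma return_time_leP (R : realType) (d : measure_display)
    (Omega : measurableType d) (I : countType)
    (X : R -> Omega -> I) (x : I) (w : Omega) (s : R) :
  (return_time X x w <= s%:E)%E <-> forall e, 0 < e ->
    exists r t, [/\ 0 < r, r < t, t < s + e, X r w <> X 0 w & X t w = x].
Proof.
split=> [H e e0|H].
  have : (return_time X x w < (s + e)%:E)%E.
    by apply: (le_lt_trans H); rewrite lte_fin ltrDl.
  move/ereal_inf_lt => [_ [t [/= /jump_time1_lt[r [r0 rt Xr]] Xt] <-]] ts.
  by exists r, t.
apply/lee_addgt0Pr => e e0; have [r [t [r0 rt te Xr Xt]]] := H e e0.
apply: (@le_trans _ _ t%:E); last by rewrite -EFinD lee_fin ltW.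
apply: ereal_inf_lbound; exists t => //=; split=> //.
by apply/jump_time1_lt; exists r.
Qed.

(** By right continuity the path is constant just after [s]. A return to [x] within that stretch
    puts the path at [x] already at time [s], and the exit preceding it must then be earlier than
    [s]. *)
Lemma return_time_le_attained (R : realType) (d : measure_display)
    (Omega : measurableType d) (I : countType)
    (X : R -> Omega -> I) (x : I) (w : Omega) (s : R) :
  (forall t, 0 <= t -> \forall u \near t^'+, X u w = X t w) ->
  0 <= s -> X 0 w = x ->
  (return_time X x w <= s%:E)%E <->
    exists r t, [/\ 0 < r, r < t, t <= s, X r w <> x & X t w = x].
Proof.
move=> rc s0 X0; split=> [|[r [t [r0 rt ts Xr Xt]]]]; last first.
  apply/return_time_leP => e e0; exists r, t; split => //.
    by rewrite (le_lt_trans ts)// ltrDl.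
  by rewrite X0.
have [e e0 He] := right_continuous_interval (rc s s0).
move=> /return_time_leP/(_ e e0)[r [t [r0 rt te]]]; rewrite X0 => Xr Xt.
have [ts|st] := leP t s; first by exists r, t.
have Xs : X s w = x by rewrite -Xt He// (ltW st).
exists r, s; split => //; rewrite ltNge; apply/negP => sr; apply: Xr.
by rewrite He ?Xs// sr (lt_trans rt).
Qed.

(** In the criterion [return_time_leP] it suffices to take [e] of the form [1 / (n + 1)] and
    rational times: the exit and the return can be moved slightly to the right without changing the
    state. *)
Lemma measurable_return_le (R : realType) (d : measure_display)
    (Omega : measurableType d) (I : countType)
    (X : R -> Omega -> I) (x : I) (s : R) :
  (forall (t : R) y, 0 <= t -> measurable [set w | X t w = y]) ->
  (forall w (t : R), 0 <= t -> \forall u \near t^'+, X u w = X t w) ->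
  measurable [set w | (return_time X x w <= s%:E)%E].
Proof.
move=> mX rc.
pose D b a : set Omega := [set w | X b w <> X 0 w] `&` [set w | X a w = x].
have mD b a : 0 <= b -> 0 <= a -> measurable (D b a).
  move=> b0 a0; apply: measurableI; last exact: mX.
  rewrite (_ : [set w | _] = ~` \bigcup_(y in [set: I])
      ([set w | X b w = y] `&` [set w | X 0 w = y])).
    apply: measurableC; apply: countable_bigcupT_measurable => [|y].
      exact: countableP.
    by apply: measurableI; exact: mX.
  apply/seteqP; split=> w /=; first by move=> E [y _ [/= ? ?]]; apply: E; congruence.
  by move=> E H; apply: E; exists (X 0 w).
pose F (n : nat) : set Omega := \bigcup_(a : rat) \bigcup_(b : rat)
  (if (0 < (ratr b : R)) && (ratr b < (ratr a : R)) &&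
      ((ratr a : R) < s + n.+1%:R^-1) then D (ratr b) (ratr a) else set0).
have mF n : measurable (F n).
  apply: bigcupT_measurable_rat => a; apply: bigcupT_measurable_rat => b.
  case: ifP => // /andP[/andP[b0 ba] _].
  by apply: mD; apply: ltW => //; exact: lt_trans ba.
rewrite (_ : [set w | _] = \bigcap_n F n); first exact: bigcapT_measurable.
apply/seteqP; split=> w /=.
  move=> /return_time_leP H n _.
  have n0 : 0 < n.+1%:R^-1 :> R by rewrite invr_gt0.
  have [r [t [r0 rt ts Xr Xt]]] := H _ n0.
  have [e1 e10 H1] := right_continuous_interval (rc w t (ltW (lt_trans r0 rt))).
  have [e2 e20 H2] := right_continuous_interval (rc w r (ltW r0)).
  have /rat_in_itvoo[a] : t < Num.min (s + n.+1%:R^-1) (t + e1).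
    by rewrite lt_min ts ltrDl.
  rewrite in_itv/= lt_min => /and3P[ta sa ae].
  have /rat_in_itvoo[b] : r < Num.min t (r + e2) by rewrite lt_min rt ltrDl.
  rewrite in_itv/= lt_min => /and3P[rb bt be].
  exists a => //; exists b => //.
  rewrite (lt_trans r0 rb) (lt_trans bt ta) sa /=; split=> /=.
    by rewrite H2// (ltW rb).
  by rewrite H1// (ltW ta).
move=> H; apply/return_time_leP => e e0.
have ne : (Num.trunc e^-1).+1%:R^-1 < e.
  by rewrite invf_plt ?posrE// truncnS_gt.
have [a _ [b _]] := H (Num.trunc e^-1) Logic.I; case: ifP => //.
move=> /andP[/andP[b0 ba] ae] [Xb Xa]; exists (ratr b), (ratr a); split => //.
by rewrite (lt_trans ae)// ltrD2l.
Qed.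

Lemma grid_avoidP (R : realType) (Omega : Type) (I : countType)
    (X : R -> Omega -> I) (h : R) (x : I) (n : nat) (s : R) (w : Omega) :
  grid_avoid X h x n s w <->
    forall j, (0 < j <= n)%N -> X (s + j%:R * h) w <> x.
Proof.
elim: n s => [s|n ih s].
  by split=> // _ j; rewrite leqn0 lt0n => /andP[/negP].
have E j : s + j.+1%:R * h = s + h + j%:R * h by rewrite mulrSr mulrDl mul1r; ring.
split=> [[/= X1 /ih H] [//|[|j]] jn|H].
- by rewrite mul1r.
- by rewrite E; exact: H.
split=> /=; first by have := H 1%N isT; rewrite mul1r.
by apply/ih => j /andP[j0 jn]; rewrite -E; exact: H.
Qed.

Lemma grid_waitP (R : realType) (Omega : Type) (I : countType)
    (X : R -> Omega -> I) (h : R) (x : I) (n : nat) (s : R) (w : Omega) :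
  X s w = x -> grid_wait X h x n s w <->
    forall j k, (j < k <= n)%N -> X (s + j%:R * h) w <> x ->
      X (s + k%:R * h) w <> x.
Proof.
elim: n s => [s _|n ih s Xs].
  by split=> // _ j k; rewrite leqn0 => /andP[+ /eqP k0]; rewrite k0.
have E j : s + j.+1%:R * h = s + h + j%:R * h by rewrite mulrSr mulrDl mul1r; ring.
split=> [[[/= X1 /(ih _ X1) H]|/grid_avoidP H]|H].
- move=> [|j] [//|k] jk; first by rewrite mul0r addr0.
  by rewrite !E; exact: H.
- by move=> j k /andP[jk kn] _; apply: H; rewrite kn (leq_ltn_trans _ jk).
have [X1|X1] := pselect (X (s + h) w = x); [left|right].
  by split=> //; apply/(ih _ X1) => j k jk; rewrite -!E; exact: H.
apply/grid_avoidP => -[//|[|j]] jn; first by rewrite mul1r.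
by apply: (H 1%N) => //; rewrite mul1r.
Qed.

(** Path by path, a fine enough grid detects whether the path has left and returned by time [s]. The
    number of steps is chosen so that the last grid point is the first one after [s]. *)
Lemma grid_wait_eventually (R : realType) (d : measure_display)
    (Omega : measurableType d) (I : countType)
    (X : R -> Omega -> I) (x : I) (w : Omega) (h : nat -> R) (s : R) :
  (forall t, 0 <= t -> \forall u \near t^'+, X u w = X t w) ->
  (forall n, 0 < h n) -> h n @[n --> \oo] --> 0 -> 0 <= s -> X 0 w = x ->
  \forall n \near \oo, grid_wait X (h n) x (Num.trunc (s / h n)).+1 0 w <->
    ~ (return_time X x w <= s%:E)%E.
Proof.
move=> rc h0 hcvg s0 X0.
have small e : 0 < e -> \forall n \near \oo, h n < e.
  by move=> e0; exact: (cvgr_lt _ hcvg).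
have trunc_gt n t : t < (Num.trunc (t / h n)).+1%:R * h n.
  by rewrite -ltr_pdivrMr// truncnS_gt.
have trunc_le n t : 0 <= t -> (Num.trunc (t / h n)).+1%:R * h n <= t + h n.
  move=> t0; rewrite -natr1 mulrDl mul1r lerD2r -ler_pdivlMr//.
  by have /andP[] := truncn_itv (divr_ge0 t0 (ltW (h0 n))).
have [Hs|Hs] := pselect (return_time X x w <= s%:E)%E; last first.
  (* No return by [s] leaves a margin [e]. A return seen on the grid happens by [s + h n], which is
     below [s + e] for small mesh. *)
  have [e e0 He] : exists2 e, 0 < e & ~ (return_time X x w <= (s + e)%:E)%E.
    apply: contrapT => H; apply: Hs; apply/lee_addgt0Pr => e e0.
    by apply: contrapT => He; apply: H; exists e.
  apply: filterS (small e e0) => n hn; split=> // _; apply/grid_waitP => //.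
  move=> j k /andP[jk kn]; rewrite !add0r => Xj Xk; apply: He.
  have j0 : (0 < j)%N.
    by rewrite lt0n; apply/eqP => j0; move: Xj; rewrite j0 mul0r.
  apply/(return_time_le_attained rc (addr_ge0 s0 (ltW e0)) X0).
  exists (j%:R * h n), (k%:R * h n); split => //.
  - by rewrite mulr_gt0 ?ltr0n.
  - by rewrite ltr_pM2r// ltr_nat.
  - rewrite (le_trans _ (le_trans (trunc_le n s s0) _))//.
      by rewrite ler_pM2r// ler_nat.
    by rewrite lerD2l ltW.
have [r [t [r0 rt ts Xr Xt]]] := (return_time_le_attained rc s0 X0).1 Hs.
have t0 := lt_trans r0 rt.
have [e1 e10 H1] := right_continuous_interval (rc r (ltW r0)).
have [e2 e20 H2] := right_continuous_interval (rc t (ltW t0)).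
apply: filterS (filterI (small _ e10) (small _ e20)) => n [hn1 hn2].
split=> // /(grid_waitP _ _ X0) H; exfalso.
(* The first grid points after the exit time [r] and the return time [t]; they lie where the path
   still has its value at [r], respectively [t], so they are distinct. *)
pose j := (Num.trunc (r / h n)).+1; pose k := (Num.trunc (t / h n)).+1.
have Xj : X (j%:R * h n) w <> x.
  rewrite H1// (ltW (trunc_gt n r)) (le_lt_trans (trunc_le n r (ltW r0)))//.
  by rewrite ltrD2l.
have Xk : X (k%:R * h n) w = x.
  rewrite H2// (ltW (trunc_gt n t)) (le_lt_trans (trunc_le n t (ltW t0)))//.
  by rewrite ltrD2l.
have jk : (j <= k)%N.
  by rewrite ltnS le_truncn// ler_pM2r ?invr_gt0// ltW.
have {}jk : (j < k)%N.
  by rewrite ltn_neqAle jk andbT; apply/eqP => E; apply: Xj; rewrite E.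
(* The extra grid step matters here: the grid point following [t <= s] may lie beyond [s]. *)
have kn : (k <= (Num.trunc (s / h n)).+1)%N.
  by rewrite ltnS le_truncn// ler_pM2r ?invr_gt0.
by have := H j k; rewrite jk kn !add0r => /(_ isT Xj).
Qed.

(** * Laplace transforms of step functions *)

Lemma integral_expR_itv (R : realType) (a b c : R) : 0 < a -> b < c ->
  (\int[lebesgue_measure]_(s in `[b, c[) (expR (- a * s))%:E =
   ((expR (- a * b) - expR (- a * c)) / a)%:E)%E.
Proof.
move=> a0 bc.
have cexp : continuous (fun s : R => expR (- a * s)).
  move=> s; apply: continuous_comp; last exact: continuous_expR.
  by apply: continuousM => //; apply: (@continuousN _ R^o); exact: cst_continuous.
rewrite integral_itv_bndo_bndc; last first.
  apply/measurable_EFinP; apply: measurable_funTS.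
  exact: continuous_measurable_fun.
pose F (s : R) : R := - (a^-1 * expR (- a * s)).
have cF : continuous F.
  by move=> s; apply: cvgN; apply: cvgM; [exact: cvg_cst|exact: cexp].
rewrite (@continuous_FTC2 _ _ F)//.
- by rewrite -EFinB /F; congr EFin; field; rewrite gt_eqF.
- exact: continuous_subspaceT.
- split.
  + by move=> z _; exact: ex_derive.
  + by apply/cvg_at_right_filter; exact: cF.
  + by apply/cvg_at_left_filter; exact: cF.
- move=> z _; rewrite /F derive1N; last exact: ex_derive.
  rewrite derive1Ml; last exact: ex_derive.
  rewrite derive1_comp// derive1E.
  have /funeqP -> := @derive_expR R.
  rewrite derive1Ml// derive1_id mulr1; field; by rewrite gt_eqF.
Qed.

Definition grid_cell (R : realType) (h : R) (k : nat) : set R :=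
  `[k%:R * h, k.+1%:R * h[%classic.

Lemma grid_cellP (R : realType) (h s : R) (k : nat) : 0 < h -> 0 <= s ->
  grid_cell h k s <-> Num.trunc (s / h) = k.
Proof.
move=> h0 s0; rewrite /grid_cell /= in_itv/= -ler_pdivlMr// -ltr_pdivrMr//.
have sh0 : 0 <= s / h by rewrite divr_ge0// ltW.
split=> [|<-]; first exact: truncn_def.
exact: truncn_itv.
Qed.

Lemma grid_cell_ge0 (R : realType) (h s : R) (k : nat) :
  0 < h -> grid_cell h k s -> 0 <= s.
Proof.
move=> h0; rewrite /grid_cell /= in_itv/= => /andP[+ _]; apply: le_trans.
by rewrite mulr_ge0// ltW.
Qed.

Lemma bigcup_grid_cell (R : realType) (h : R) : 0 < h ->
  \bigcup_k grid_cell h k = `[0, +oo[%classic.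
Proof.
move=> h0; apply/seteqP; split=> s.
  by case=> k _ /(grid_cell_ge0 h0) s0 /=; rewrite in_itv/= s0.
rewrite /= in_itv/= andbT => s0; exists (Num.trunc (s / h)) => //.
exact/grid_cellP.
Qed.

Lemma measurable_grid_cell (R : realType) (h : R) (k : nat) :
  measurable (grid_cell h k).
Proof. exact: measurable_itv. Qed.

Lemma integral_grid_cell (R : realType) (h : R) (f : R -> \bar R) :
  0 < h -> measurable_fun (`[0, +oo[%classic : set R) f ->
  (forall s, 0 <= s -> (0 <= f s)%E) ->
  (\int[lebesgue_measure]_(s in `[0%R, +oo[) f s =
   \sum_(k <oo) \int[lebesgue_measure]_(s in grid_cell h k) f s)%E.
Proof.
move=> h0 mf f0; rewrite -(bigcup_grid_cell h0) ge0_integral_bigcup//.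
- exact: measurable_grid_cell.
- by rewrite bigcup_grid_cell.
- move=> s; rewrite bigcup_grid_cell//= in_itv/= andbT; exact: f0.
- move=> j k _ _ [s [sj sk]]; have s0 := grid_cell_ge0 h0 sj.
  by rewrite -(grid_cellP j h0 s0).1// -(grid_cellP k h0 s0).1.
Qed.

Lemma measurable_step (R : realType) (h : R) (c : nat -> R) : 0 < h ->
  measurable_fun (`[0, +oo[%classic : set R) (fun s : R => c (Num.trunc (s / h))).
Proof.
move=> h0; rewrite -(bigcup_grid_cell h0).
apply/measurable_fun_bigcup => k; first exact: measurable_grid_cell.
apply: (@eq_measurable_fun _ _ _ _ _ (fun=> c k)) => // s.
rewrite inE => sk; have s0 := grid_cell_ge0 h0 sk.
by rewrite (grid_cellP k h0 s0).1.
Qed.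

Lemma measurable_expR_decay (R : realType) (a : R) (D : set R) :
  measurable_fun D (fun s : R => expR (- a * s)).
Proof.
apply: measurable_funTS; apply: continuous_measurable_fun => s.
apply: continuous_comp; last exact: continuous_expR.
by apply: continuousM => //; apply: (@continuousN _ R^o); exact: cst_continuous.
Qed.

(** On the [k]-th cell the exponential integrates to [z ^+ k * (1 - z) / a] with
    [z = expR (- a * h)], which produces the generating function at [z]. *)
Lemma integral_step (R : realType) (a h : R) (c : nat -> R) :
  0 < a -> 0 < h -> (forall k, 0 <= c k) ->
  (\int[lebesgue_measure]_(s in `[0%R, +oo[)
     (expR (- a * s) * c (Num.trunc (s / h)))%:E =
   ((1 - expR (- a * h)) / a)%:E * gsum (expR (- a * h)) c)%E.
Proof.
move=> a0 h0 c0; rewrite (integral_grid_cell h0); last 2 first.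
- apply/measurable_EFinP; apply: measurable_funM.
    exact: measurable_expR_decay.
  exact: measurable_step.
- by move=> s _; rewrite lee_fin mulr_ge0// expR_ge0.
rewrite /gsum -nneseriesZl; last first.
  by move=> k _; rewrite lee_fin mulr_ge0// exprn_ge0// expR_ge0.
apply: eq_eseriesr => k _.
transitivity (\int[lebesgue_measure]_(s in grid_cell h k)
    ((c k)%:E * (expR (- a * s))%:E))%E.
  apply: eq_integral => s; rewrite inE => sk.
  by rewrite (grid_cellP k h0 (grid_cell_ge0 h0 sk)).1// -EFinM mulrC.
rewrite ge0_integralZl_EFin//; last 2 first.
- exact: measurable_grid_cell.
- by apply/measurable_EFinP; exact: measurable_expR_decay.
rewrite integral_expR_itv//; last by rewrite ltr_pM2r// ltr_nat.
rewrite -!EFinM; congr EFin.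
have -> : - a * (k.+1%:R * h) = - a * h + - a * (k%:R * h).
  by rewrite -natr1; ring.
have -> : - a * (k%:R * h) = k%:R * (- a * h) by ring.
rewrite expRD expRM_natl; ring.
Qed.

Lemma integral_expR_y (R : realType) (a : R) : 0 < a ->
  (\int[lebesgue_measure]_(s in `[0%R, +oo[) (expR (- a * s))%:E = (a^-1)%:E)%E.
Proof.
(* The constant 1 is viewed as a step function of mesh 1, so that the improper integral becomes a
   geometric series. *)
move=> a0; pose c : nat -> R := fun=> 1.
transitivity (\int[lebesgue_measure]_(s in `[0%R, +oo[)
    (expR (- a * s) * c (Num.trunc (s / 1)))%:E)%E.
  by apply: eq_integral => s _; rewrite /c mulr1.
have z01 : 0 <= expR (- a * 1) < 1.
  by rewrite expR_ge0 expR_lt1 mulr1 oppr_lt0.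
rewrite integral_step ?ltr01// gsum1// -EFinM; congr EFin; field.
by rewrite gt_eqF//= subr_eq0 gt_eqF//; case/andP: z01.
Qed.

Lemma decay_integrable (R : realType) (a : R) : 0 < a ->
  (@lebesgue_measure R).-integrable `[0%R, +oo[%classic
    (fun s => (expR (- a * s))%:E).
Proof.
move=> a0; apply/integrableP; split.
  by apply/measurable_EFinP; exact: measurable_expR_decay.
under eq_integral => s _ do rewrite abse_EFin ger0_norm ?expR_ge0//.
by rewrite integral_expR_y// ltry.
Qed.

Lemma laplace_integrable (R : realType) (a : R) (g : R -> R) : 0 < a ->
  measurable_fun (`[0, +oo[%classic : set R) g ->
  (forall s, 0 <= s -> 0 <= g s <= 1) ->
  (@lebesgue_measure R).-integrable `[0%R, +oo[%classic
    (fun s => (expR (- a * s) * g s)%:E).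
Proof.
move=> a0 mg g01; apply: (le_integrable _ _ _ (decay_integrable a0)) => //.
  apply/measurable_EFinP; apply: measurable_funM => //.
  exact: measurable_expR_decay.
move=> s; rewrite /= in_itv/= andbT => /g01/andP[g0 g1].
by rewrite lee_fin !ger0_norm ?mulr_ge0 ?expR_ge0// ler_piMr ?expR_ge0.
Qed.

(* Riemann sums on grids of vanishing mesh, written as integrals of step
   functions so that dominated convergence applies. *)
Lemma cvg_laplace_gsum (R : realType) (a : R) (g : R -> R) (h : nat -> R)
    (c : nat -> nat -> R) : 0 < a ->
  measurable_fun (`[0, +oo[%classic : set R) g ->
  (forall n, 0 < h n) -> (forall n k, 0 <= c n k <= 1) ->
  (forall s, 0 <= s -> c n (Num.trunc (s / h n)) @[n --> \oo] --> g s) ->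
  (1 - expR (- a * h n)) / a * fine (gsum (expR (- a * h n)) (c n))
    @[n --> \oo] -->
  \int[lebesgue_measure]_(s in `[0, +oo[) (expR (- a * s) * g s).
Proof.
move=> a0 mg h0 c01 ccvg.
have c0 n k : 0 <= c n k by case/andP: (c01 n k).
pose D : set R := `[0%R, +oo[%classic.
have mD : measurable D by exact: measurable_itv.
pose f n s : \bar R := (expR (- a * s) * c n (Num.trunc (s / h n)))%:E.
have mf n : measurable_fun D (f n).
  apply/measurable_EFinP; apply: measurable_funM.
    exact: measurable_expR_decay.
  exact: measurable_step.
have mF : measurable_fun D (fun s => (expR (- a * s) * g s)%:E).
  apply/measurable_EFinP; apply: measurable_funM => //.
  exact: measurable_expR_decay.
have fcvg : {ae lebesgue_measure, forall s, D s ->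
    f ^~ s @ \oo --> (expR (- a * s) * g s)%:E}.
  apply: aeW => s; rewrite /D /= in_itv/= andbT => s0.
  apply: cvg_EFin; first exact: nearW.
  by apply: cvgM; [exact: cvg_cst|exact: ccvg].
have fdom : {ae lebesgue_measure, forall s n, D s ->
    (`|f n s| <= (expR (- a * s))%:E)%E}.
  apply: aeW => s n _; rewrite /f abse_EFin lee_fin ger0_norm; last first.
    by rewrite mulr_ge0// expR_ge0.
  by rewrite ler_piMr ?expR_ge0//; case/andP: (c01 n (Num.trunc (s / h n))).
have [ig _] := @dominated_convergence _ _ _ (@lebesgue_measure R) D
  mD f _ _ mf mF fcvg (decay_integrable a0) fdom.
have fin : (\int[lebesgue_measure]_(s in D) (expR (- a * s) * g s)%:E)%E
    \is a fin_num.
  by apply: integrable_fin_num ig.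
rewrite -(fineK fin) => /fine_cvgP[_]; apply: cvg_trans; apply: near_eq_cvg.
apply: nearW => n /=; rewrite /f integral_step// fineM//=.
apply: gsum_fin_num => //.
by rewrite expR_ge0 expR_lt1 mulNr oppr_lt0 mulr_gt0.
Qed.

(** * Comparison of windows *)

Lemma unit_integrable_itv (R : realType) (b c : R) (f : R -> R) : 0 <= b ->
  measurable_fun (`[0, +oo[%classic : set R) f ->
  (forall s, 0 <= s -> 0 <= f s <= 1) ->
  (@lebesgue_measure R).-integrable `[b, c[%classic (EFin \o f).
Proof.
move=> b0 mf f01; apply: measurable_bounded_integrable => //.
- by rewrite /= lebesgue_measure_itv/=; case: ifP => // _; rewrite -EFinB ltry.
- apply: measurable_funS mf => // s /=; rewrite !in_itv/= andbT => /andP[+ _].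
  exact: le_trans.
- exists 1; split => // M M1 s /=; rewrite in_itv/= => /andP[bs _].
  have /andP[f0 f1] := f01 s (le_trans b0 bs).
  by rewrite ger0_norm// (le_trans f1)// ltW.
Qed.

Lemma le_Rintegral_cst (R : realType) (b h u v : R) (f : R -> R) :
  0 <= b -> 0 <= h ->
  measurable_fun (`[0, +oo[%classic : set R) f ->
  (forall s, 0 <= s -> 0 <= f s <= 1) ->
  (forall s, b <= s < b + h -> u <= f s <= v) ->
  h * u <= \int[lebesgue_measure]_(s in `[b, b + h[) f s <= h * v.
Proof.
move=> b0 h0 mf f01 fuv.
have fi := unit_integrable_itv (b + h) b0 mf f01.
have mbh : fine (lebesgue_measure (`[b, b + h[%classic : set R)) = h.
  rewrite lebesgue_measure_itv/= lte_fin; case: ltP => bh /=.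
    by rewrite addrAC subrr add0r.
  by apply/eqP; rewrite eq_le h0 -(gerDl b).
have ci (r : R) : (@lebesgue_measure R).-integrable `[b, b + h[%classic
    (EFin \o cst r).
  apply: measurable_bounded_integrable => //.
    rewrite /= lebesgue_measure_itv/=; case: ifP => // _.
    by rewrite -EFinB ltry.
  by exists `|r|; split => // M rM s _; exact: ltW.
have E (r : R) : h * r = \int[lebesgue_measure]_(_ in `[b, b + h[) r.
  by rewrite Rintegral_cst// mbh mulrC.
rewrite !E; apply/andP; split; apply: le_Rintegral; rewrite //;
  try exact: ci; by move=> s; rewrite /= in_itv/= => /fuv/andP[].
Qed.

(** On each cell [f] stays within [e] of its value at the left endpoint, so the cell contributes an
    error of at most [h * e]. *)
Lemma Rintegral_riemann (R : realType) (h e b : R) (f : R -> R) (N : nat) :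
  0 <= b -> 0 <= h ->
  measurable_fun (`[0, +oo[%classic : set R) f ->
  (forall s, 0 <= s -> 0 <= f s <= 1) ->
  (forall s r, 0 <= s -> 0 <= r < h -> `|f (s + r) - f s| <= e) ->
  `|\int[lebesgue_measure]_(s in `[b, b + N%:R * h[) f s -
    h * \sum_(k < N) f (b + k%:R * h)| <= N%:R * h * e.
Proof.
move=> b0 h0 mf f01 fmod; elim: N => [|N ih].
  rewrite big_ord0 mulr0 !mul0r addr0 subr0 set_itv_ge ?Rintegral_set0 ?normr0//.
  by rewrite bnd_simp ltxx.
have bN : 0 <= b + N%:R * h by rewrite addr_ge0// mulr_ge0.
have NS : b + N.+1%:R * h = b + N%:R * h + h by rewrite -natr1 mulrDl mul1r addrA.
have -> : \int[lebesgue_measure]_(s in `[b, b + N.+1%:R * h[) f s =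
    \int[lebesgue_measure]_(s in `[b, b + N%:R * h[) f s +
    \int[lebesgue_measure]_(s in `[b + N%:R * h, b + N%:R * h + h[) f s.
  have U : `[b, b + N.+1%:R * h[%classic = `[b, b + N%:R * h[%classic `|`
      `[b + N%:R * h, b + N%:R * h + h[%classic :> set R.
    rewrite NS; apply: itv_bndbnd_setU; rewrite bnd_simp ?lerDl//.
    exact: mulr_ge0.
  rewrite U Rintegral_setU//.
  - by rewrite -U; exact: unit_integrable_itv.
  - apply/disj_setPS => s [] /=; rewrite !in_itv/= => /andP[_ sl] /andP[sr _].
    by move: (lt_le_trans sl sr); rewrite ltxx.
have := @le_Rintegral_cst _ _ _ (f (b + N%:R * h) - e) (f (b + N%:R * h) + e)
  _ bN h0 mf f01.
case/(_ _)/andP.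
  move=> s /andP[bs sb]; have := fmod _ (s - (b + N%:R * h)) bN.
  rewrite subr_ge0 bs ltrBlDl sb => /(_ isT); rewrite [_ + (s - _)]addrC subrK.
  by rewrite ler_norml; lra.
move: ih; rewrite big_ord_recr /= !ler_norml -natr1.
set J := Rintegral _ _ _; set K := Rintegral _ _ _.
set S := \sum_(_ < N) _; lra.
Qed.

(* The comparison of sums over [N] consecutive grid points passes to the limit
   of vanishing mesh. *)
Lemma Rintegral_window_le (R : realType) (f : R -> R) (b t : R) :
  0 <= b -> 0 < t ->
  measurable_fun (`[0, +oo[%classic : set R) f ->
  (forall s, 0 <= s -> 0 <= f s <= 1) ->
  (forall e, 0 < e -> exists2 r0, 0 < r0 &
    forall s r, 0 <= s -> 0 <= r < r0 -> `|f (s + r) - f s| <= e) ->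
  (forall h N, 0 < h ->
    \sum_(k < N) f (b + k%:R * h) <= \sum_(k < N) f (0 + k%:R * h)) ->
  \int[lebesgue_measure]_(s in `[b, b + t[) f s <=
  \int[lebesgue_measure]_(s in `[0, t[) f s.
Proof.
move=> b0 t0 mf f01 fmod fgrid; apply/ler_addgt0Pr => e e0.
(* Each of the two Riemann sums is off by at most [t * (e / (2 * t)) = e / 2], once [N] is large
   enough for the mesh [t / N] to be below [r0]. *)
have [|r0 r00 Hr] := fmod (e / (2 * t)); first by rewrite divr_gt0// mulr_gt0.
pose N := (Num.trunc (t / r0)).+1; pose h := t / N%:R.
have N0 : 0 < N%:R :> R by rewrite ltr0n.
have h0 : 0 < h by rewrite divr_gt0.
have Nh : N%:R * h = t by rewrite mulrC divfK// gt_eqF.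
have hr : h < r0.
  by rewrite /h ltr_pdivrMr// mulrC -ltr_pdivrMr// /N truncnS_gt.
have Hh s r : 0 <= s -> 0 <= r < h -> `|f (s + r) - f s| <= e / (2 * t).
  by move=> s0 /andP[r1 r2]; apply: Hr => //; rewrite r1 (lt_trans r2).
have := Rintegral_riemann N b0 (ltW h0) mf f01 Hh.
have := Rintegral_riemann N (lexx 0) (ltW h0) mf f01 Hh.
rewrite Nh add0r !ler_norml.
have := fgrid h N h0; rewrite -(ler_pM2l h0).
have -> : t * (e / (2 * t)) = e / 2 by field; rewrite gt_eqF.
set J := Rintegral _ _ _; set K := Rintegral _ _ _.
set S := \sum_(_ < N) _; set S' := \sum_(_ < N) _; lra.
Qed.

(* Split the half-line into windows of length [t]: on the [m]-th one the
   exponential weight is at most [exp (- m)]. *)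
Lemma laplace_window_bounds (R : realType) (f : R -> R) (t : R) : 0 < t ->
  measurable_fun (`[0, +oo[%classic : set R) f ->
  (forall s, 0 <= s -> 0 <= f s <= 1) ->
  (forall m, \int[lebesgue_measure]_(s in `[m%:R * t, m%:R * t + t[) f s <=
    \int[lebesgue_measure]_(s in `[0, t[) f s) ->
  (1 - (expR 1)^-1) *
    \int[lebesgue_measure]_(s in `[0, +oo[) (expR (- t^-1 * s) * f s) <=
  \int[lebesgue_measure]_(s in `[0, t]) f s <=
  expR 1 *
    \int[lebesgue_measure]_(s in `[0, +oo[) (expR (- t^-1 * s) * f s).
Proof.
move=> t0 mf f01 fwin.
set S := \int[lebesgue_measure]_(s in `[0, t]) f s.
set G := \int[lebesgue_measure]_(s in `[0, +oo[) (expR (- t^-1 * s) * f s).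
have ti0 : 0 < t^-1 by rewrite invr_gt0.
have SE : S = \int[lebesgue_measure]_(s in `[0, t[) f s.
  rewrite /S -Rintegral_itv_bndo_bndc//; exact: unit_integrable_itv.
have Gi := laplace_integrable ti0 mf f01.
have GE : G%:E = (\int[lebesgue_measure]_(s in `[0%R, +oo[)
    (expR (- t^-1 * s) * f s)%:E)%E.
  by rewrite fineK//; apply: integrable_fin_num Gi.
have mw (D : set R) : measurable D -> D `<=` `[0%R, +oo[%classic ->
    measurable_fun D (fun s => (expR (- t^-1 * s) * f s)%:E).
  move=> mD D0; apply/measurable_EFinP; apply: measurable_funM.
    exact: measurable_expR_decay.
  exact: measurable_funS mf.
have f0 s : 0 <= s -> 0 <= f s by move=> /f01/andP[].
have cellE m : grid_cell t m = `[m%:R * t, m%:R * t + t[%classic.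
  by rewrite /grid_cell -natr1 mulrDl mul1r.
have cell0 m : grid_cell t m `<=` `[0%R, +oo[%classic.
  by move=> s /(grid_cell_ge0 t0) s0; rewrite /= in_itv/= s0.
have win0 b : 0 <= b -> `[b, b + t[%classic `<=` (`[0, +oo[%classic : set R).
  by move=> b0 s; rewrite /= !in_itv/= andbT => /andP[+ _]; exact: le_trans.
have winE b : 0 <= b -> ((\int[lebesgue_measure]_(s in `[b, (b + t)%R[) f s)%:E =
    \int[lebesgue_measure]_(s in `[b, (b + t)%R[) (f s)%:E)%E.
  move=> b0; rewrite fineK//.
  by apply: integrable_fin_num (unit_integrable_itv _ b0 mf f01).
apply/andP; split.
(* Lower bound: the windows contribute at most [expR (-1) ^+ m] times the integral over the first
   one, and these weights sum to [(1 - expR (-1))^-1]. *)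
- have e1 : 0 <= (expR (-1) : R) < 1 by rewrite expR_ge0 expR_lt1 ltrN10.
  rewrite -expRN mulrC -ler_pdivlMr; last by rewrite subr_gt0; case/andP: e1.
  rewrite -lee_fin EFinM GE (integral_grid_cell t0); last 2 first.
  + by apply: mw.
  + by move=> s s0; rewrite lee_fin mulr_ge0 ?expR_ge0// f0.
  rewrite -gsum1// /gsum -nneseriesZl; last first.
    by move=> k _; rewrite lee_fin mulr_ge0// exprn_ge0// expR_ge0.
  apply: lee_nneseries => [m _ _|m _].
    apply: integral_ge0 => s /(grid_cell_ge0 t0) s0.
    by rewrite lee_fin mulr_ge0 ?expR_ge0// f0.
  have mt0 : 0 <= m%:R * t by rewrite mulr_ge0// ltW.
  apply: (@le_trans _ _ (\int[lebesgue_measure]_(s in grid_cell t m)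
      ((expR (-1) ^+ m)%:E * (f s)%:E))%E).
    apply: ge0_le_integral => //.
    + exact: measurable_grid_cell.
    + move=> s /(grid_cell_ge0 t0) s0.
      by rewrite lee_fin mulr_ge0 ?expR_ge0// f0.
    + by apply: mw => //; exact: measurable_grid_cell.
    + apply/measurable_EFinP; apply: measurable_funM => //.
      exact: measurable_funS mf.
    + move=> s ms; have s0 := grid_cell_ge0 t0 ms.
      rewrite -EFinM lee_fin ler_wpM2r ?f0// -expRM_natl ler_expR mulrN1 mulNr.
      rewrite lerN2 mulrC ler_pdivlMr//.
      by move: ms; rewrite /grid_cell /= in_itv/= => /andP[].
  rewrite ge0_integralZl_EFin//; last 3 first.
  + exact: measurable_grid_cell.
  + by move=> s /(grid_cell_ge0 t0) s0; rewrite lee_fin f0.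
  + by apply/measurable_EFinP; exact: measurable_funS mf.
  rewrite cellE -winE// -!EFinM lee_fin mulr1 mulrC.
  by rewrite ler_wpM2r ?exprn_ge0 ?expR_ge0// SE; exact: fwin.
(* Upper bound: on the first window the exponential weight is at least [expR (-1)], and the rest of
   the transform is nonnegative. *)
- rewrite -lee_fin EFinM GE SE.
  have -> : `[0, t[%classic = `[0, 0 + t[%classic :> set R by rewrite add0r.
  rewrite winE//.
  rewrite -ge0_integralZl_EFin ?expR_ge0//; last 2 first.
  + move=> s; rewrite /= in_itv/= andbT => s0.
    by rewrite lee_fin mulr_ge0 ?expR_ge0// f0.
  + exact: mw.
  apply: (@le_trans _ _ (\int[lebesgue_measure]_(s in `[0%R, (0 + t)%R[)
      ((expR 1)%:E * (expR (- t^-1 * s) * f s)%:E))%E).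
    apply: ge0_le_integral => //.
    + by move=> s; rewrite /= in_itv/= => /andP[s0 _]; rewrite lee_fin f0.
    + apply/measurable_EFinP; by apply: measurable_funS mf => //; exact: win0.
    + apply/measurable_EFinP; apply: measurable_funM => //.
      apply: measurable_funM; first exact: measurable_expR_decay.
      by apply: measurable_funS mf => //; exact: win0.
    + move=> s; rewrite /= in_itv/= add0r => /andP[s0 st].
      rewrite -EFinM lee_fin mulrA -expRD -[leLHS]mul1r ler_wpM2r ?f0//.
      by rewrite -[leLHS]expR0 ler_expR mulNr subr_ge0 mulrC ler_pdivrMr// mul1r ltW.
  apply: ge0_subset_integral => //.
  + apply/measurable_EFinP; apply: measurable_funM => //.
    by apply: measurable_funM; first exact: measurable_expR_decay.
  + move=> s; rewrite /= in_itv/= andbT => s0.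
    by rewrite -EFinM lee_fin !mulr_ge0 ?expR_ge0// f0.
  + by move=> s; rewrite /= !in_itv/= andbT => /andP[].
Qed.

(** * Transition function and return distribution *)

Lemma transition_le1_point (R : realType) (I : countType)
    (P : R -> I -> I -> R) (t : R) (y z : I) :
  transition_function P -> 0 <= t -> P t y z <= 1.
Proof.
move=> PP t0; rewrite -lee_fin (le_trans _ (transition_le1 PP y t0))//.
rewrite -(@esum_delta _ _ z (P t y)); last exact: transition_ge0.
apply: le_esum => y' _; rewrite lee_fin ler_piMl ?(transition_ge0 PP)//.
by case: eqP.
Qed.

(** Write [P (s + r) x x] as the mean of [P s y x] over the state [y] at time [r], and, by honesty,
    [1 - P (s + r) x x] as the mean of [1 - P s y x]. Keeping only the term [y = x] in each bounds
    the increment from both sides. *)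
Lemma transition_modulus (R : realType) (I : countType)
    (P : R -> I -> I -> R) (s r : R) (x : I) :
  transition_function P -> honest P -> 0 <= s -> 0 <= r ->
  `|P (s + r) x x - P s x x| <= 1 - P r x x.
Proof.
move=> PP hP s0 r0; have p0 := @transition_ge0 _ _ _ PP.
have term (g : I -> R) : (forall y, 0 <= g y) ->
    ((P r x x * g x)%:E <= \esum_(y in [set: I]) (P r x y * g y)%:E)%E.
  move=> g0; rewrite -(@esum_delta _ _ x (fun y => P r x y * g y)).
    apply: le_esum => y _; rewrite lee_fin ler_piMl ?mulr_ge0 ?p0//.
    by case: eqP.
  by rewrite mulr_ge0// p0.
have lo := term (fun y => P s y x) (fun y => p0 _ _ _ s0).
have le1 y : P s y x <= 1 by exact: transition_le1_point.
have up := term (fun y => 1 - P s y x).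
have {up}/up : forall y, 0 <= 1 - P s y x by move=> y; rewrite subr_ge0.
have E : (\esum_(y in [set: I]) (P r x y * P s y x)%:E +
    \esum_(y in [set: I]) (P r x y * (1 - P s y x))%:E = 1)%E.
  rewrite -esumD; last 2 first.
  - by move=> y _; rewrite lee_fin mulr_ge0// p0.
  - by move=> y _; rewrite lee_fin mulr_ge0 ?p0// subr_ge0.
  rewrite -(hP r x r0); apply: eq_esum => y _.
  by rewrite -EFinD; congr EFin; ring.
move: lo E; rewrite -transitionD// [r + s]addrC.
set B := (\esum_(y in _) (_ * (1 - _))%:E)%E => lo E; rewrite lee_fin in lo.
have -> : B = (1 - P (s + r) x x)%:E.
  by rewrite EFinB -E addrAC subee// add0e.
rewrite lee_fin => up; rewrite ler_norml.
have := le1 x; have := transition_le1_point x x PP r0.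
by have := p0 s x x s0; have := p0 r x x r0; nra.
Qed.

Lemma standard_modulus (R : realType) (I : countType)
    (P : R -> I -> I -> R) (x : I) :
  transition_function P -> honest P -> standard P ->
  forall e, 0 < e -> exists2 r0, 0 < r0 &
    forall s r, 0 <= s -> 0 <= r < r0 -> `|P (s + r) x x - P s x x| <= e.
Proof.
move=> PP hP sP e e0; have := sP x x; rewrite eqxx => /cvgrPdist_le/(_ e e0).
case=> r0 /= r00 H; exists r0 => // s r s0 /andP[r1 r2].
apply: (le_trans (transition_modulus x PP hP s0 r1)).
(* The limit from the right does not see [r = 0], where [P 0 x x = 1] settles the bound. *)
move: r1; rewrite le_eqVlt => /predU1P[<-|r1].
  by rewrite (transition0 PP) eqxx subrr ltW.
apply: (le_trans (ler_norm _)); apply: H => //=.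
by rewrite sub0r normrN gtr0_norm.
Qed.

(** The modulus is applied at the grid point just left of [s]; this point moves with [n], so
    uniformity in the base point is essential. *)
Lemma cvg_skeleton (R : realType) (f : R -> R) (h : nat -> R) (s : R) :
  (forall e, 0 < e -> exists2 r0, 0 < r0 &
    forall s r, 0 <= s -> 0 <= r < r0 -> `|f (s + r) - f s| <= e) ->
  (forall n, 0 < h n) -> h n @[n --> \oo] --> 0 -> 0 <= s ->
  f ((Num.trunc (s / h n))%:R * h n) @[n --> \oo] --> f s.
Proof.
move=> fmod h0 hcvg s0; apply/cvgrPdist_le => e /fmod[r0 r00 H].
have : \forall n \near \oo, h n < r0 by exact: (cvgr_lt _ hcvg).
apply: filterS => n hn.
have /andP[lo up] := truncn_itv (divr_ge0 s0 (ltW (h0 n))).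
rewrite ler_pdivlMr// in lo; rewrite ltr_pdivrMr// -natr1 mulrDl mul1r in up.
set t := _%:R * h n in lo up *.
rewrite -{1}(subrK t s) [_ - _ + _]addrC; apply: H; first by rewrite mulr_ge0// ltW.
by rewrite subr_ge0 lo ltrBlDl (lt_trans up)// ltrD2l.
Qed.

Lemma harmonic_gt0 (R : realType) (n : nat) : 0 < (n.+1%:R^-1 : R).
Proof. by rewrite invr_gt0. Qed.

(** On the half-line [f] is a pointwise limit of step functions on the grids of mesh
    [1 / (n + 1)]. *)
Lemma measurable_modulus (R : realType) (f : R -> R) :
  (forall e, 0 < e -> exists2 r0, 0 < r0 &
    forall s r, 0 <= s -> 0 <= r < r0 -> `|f (s + r) - f s| <= e) ->
  measurable_fun (`[0, +oo[%classic : set R) f.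
Proof.
move=> fmod.
pose g n (s : R) := f ((Num.trunc (s / n.+1%:R^-1))%:R * n.+1%:R^-1).
apply: (@measurable_fun_cvg _ _ R _ g) => [n|s].
  exact: (measurable_step (fun k => f (k%:R * n.+1%:R^-1)) (harmonic_gt0 R n)).
rewrite /= in_itv/= andbT => s0.
exact: (cvg_skeleton fmod (@harmonic_gt0 R) (@cvg_harmonic R)).
Qed.

Lemma visits_skeleton (R : realType) (I : countType)
    (P : R -> I -> I -> R) (h : R) (x : I) :
  transition_function P -> 0 <= h ->
  visits (P h) x (fun k y => P (k%:R * h) y x).
Proof.
move=> PP h0; have kh0 k : 0 <= k%:R * h by rewrite mulr_ge0.
split=> [k y|y|k y]; first exact: transition_ge0.
  by rewrite mul0r (transition0 PP).
by rewrite -(transitionD PP)// -natr1 mulrDl mul1r addrC.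
Qed.

(** Conditioning on the state [y] at time [b] makes the left side an average of expected visit
    counts started at [y], each bounded through [visits_le]. *)
Lemma skeleton_window_le (R : realType) (I : countType)
    (P : R -> I -> I -> R) (x : I) (b h : R) (N : nat) :
  transition_function P -> honest P -> 0 <= b -> 0 < h ->
  \sum_(k < N) P (b + k%:R * h) x x <= \sum_(k < N) P (0 + k%:R * h) x x.
Proof.
move=> PP hP b0 /ltW h0; have kh0 k : 0 <= k%:R * h by rewrite mulr_ge0.
have vP := visits_skeleton x PP h0.
have sP := stochastic_transition PP hP h0.
rewrite -lee_fin -sumEFin.
under eq_bigr => k _ do rewrite (transitionD PP)//.
rewrite -esum_sum; last first.
  by move=> y k _ _; rewrite lee_fin mulr_ge0 ?(transition_ge0 PP).
rewrite (eq_esum (b := fun y => (P b x y * \sum_(k < N) P (k%:R * h) y x)%:E));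
  last by move=> y _; rewrite sumEFin mulr_sumr.
apply: stochastic_mean_le; first exact: stochastic_transition.
  by apply: sumr_ge0 => k _; rewrite add0r (transition_ge0 PP).
move=> y; have := visits_le N y sP vP.
by under [leRHS]eq_bigr => k _ do rewrite -[_ * _]add0r.
Qed.

Lemma return_cdf_EFin (R : realType) (d : measure_display)
    (Omega : measurableType d) (I : countType)
    (Pr : I -> probability Omega R) (X : R -> Omega -> I)
    (P : R -> I -> I -> R) (x : I) (s : R) : markov_chain Pr X P ->
  (return_cdf Pr X x s)%:E = Pr x [set w | (return_time X x w <= s%:E)%E].
Proof.
move=> [mX rc _ _]; rewrite fineK//; apply: fin_num_measure.
exact: measurable_return_le.
Qed.

Lemma return_cdf_ge0_le1 (R : realType) (d : measure_display)
    (Omega : measurableType d) (I : countType)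
    (Pr : I -> probability Omega R) (X : R -> Omega -> I)
    (P : R -> I -> I -> R) (x : I) (s : R) : markov_chain Pr X P ->
  0 <= return_cdf Pr X x s <= 1.
Proof.
move=> mc; rewrite -!lee_fin (return_cdf_EFin _ _ mc) measure_ge0 /=.
apply: probability_le1; apply: measurable_return_le.
  exact: chain_measurable mc.
exact: chain_right_continuous mc.
Qed.

Lemma return_cdf_nondecreasing (R : realType) (d : measure_display)
    (Omega : measurableType d) (I : countType)
    (Pr : I -> probability Omega R) (X : R -> Omega -> I)
    (P : R -> I -> I -> R) (x : I) (s t : R) : markov_chain Pr X P ->
  s <= t -> return_cdf Pr X x s <= return_cdf Pr X x t.
Proof.
move=> mc st; rewrite -lee_fin !(return_cdf_EFin _ _ mc).
have [mX rc _ _] := mc.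
apply: le_measure; rewrite ?inE; [exact: measurable_return_le..|].
by move=> w /= ws; rewrite (le_trans ws)// lee_fin.
Qed.

(** Monotonicity of the tail gives both parts. For [m > 0] the two integrals are separated by
    [t * g t]: the tail is at most [g t] after time [t] and at least [g t] before. *)
Lemma return_tail_window_le (R : realType) (d : measure_display)
    (Omega : measurableType d) (I : countType)
    (Pr : I -> probability Omega R) (X : R -> Omega -> I)
    (P : R -> I -> I -> R) (x : I) (t : R) (m : nat) :
  markov_chain Pr X P -> 0 < t ->
  measurable_fun (`[0, +oo[%classic : set R)
    (fun s => 1 - return_cdf Pr X x s) /\
  \int[lebesgue_measure]_(s in `[m%:R * t, m%:R * t + t[)
    (1 - return_cdf Pr X x s) <=
  \int[lebesgue_measure]_(s in `[0, t[) (1 - return_cdf Pr X x s).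
Proof.
move=> mc t0; set g := fun s => 1 - return_cdf Pr X x s.
have gle s r : s <= r -> g r <= g s.
  by move=> sr; rewrite lerB//; exact: (return_cdf_nondecreasing _ mc).
have mg : measurable_fun (`[0, +oo[%classic : set R) g.
  by apply: nonincreasing_measurable => // s r; exact: gle.
have g01 s : 0 <= s -> 0 <= g s <= 1.
  move=> _; have /andP[] := return_cdf_ge0_le1 x s mc.
  by rewrite subr_ge0 gerBl => -> ->.
split=> //; case: m => [|m]; first by rewrite mul0r add0r.
have mt0 : 0 <= m.+1%:R * t by rewrite mulr_ge0// ltW.
have /andP[_ up] : t * 0 <= \int[lebesgue_measure]_(s in
    `[m.+1%:R * t, m.+1%:R * t + t[) g s <= t * g t.
  apply: le_Rintegral_cst => //; first exact: ltW.
  move=> s /andP[ms _]; apply/andP; split.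
    by have /andP[] := g01 s (le_trans mt0 ms).
  by apply: gle; rewrite (le_trans _ ms)// ler_peMl ?ler1n// ltW.
have /andP[lo _] : t * g t <= \int[lebesgue_measure]_(s in
    `[0, 0 + t[) g s <= t * 1.
  apply: le_Rintegral_cst => //; first exact: ltW.
  move=> s; rewrite add0r => /andP[s0 /ltW st]; rewrite gle//.
  by have /andP[] := g01 s s0.
by rewrite add0r in lo; exact: le_trans lo.
Qed.

(** By [prob_grid_wait0] these numbers are probabilities of events. *)
Lemma wait_ge0_le1 (R : realType) (d : measure_display)
    (Omega : measurableType d) (I : countType)
    (Pr : I -> probability Omega R) (X : R -> Omega -> I)
    (P : R -> I -> I -> R) (h : R) (x : I) (n : nat) :
  markov_chain Pr X P -> 0 <= h -> stochastic (P h) ->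
  0 <= wait (P h) x n <= 1.
Proof.
move=> mc h0 sp; rewrite -!lee_fin -(prob_grid_wait0 x n mc h0 sp) measure_ge0.
apply: probability_le1; apply: measurable_grid_wait => //.
exact: chain_measurable mc.
Qed.

(** Dominated convergence for the indicators of the grid events, which converge almost surely to the
    indicator of no return by time [s]. *)
Lemma cvg_wait (R : realType) (d : measure_display)
    (Omega : measurableType d) (I : countType)
    (Pr : I -> probability Omega R) (X : R -> Omega -> I)
    (P : R -> I -> I -> R) (x : I) (h : nat -> R) (s : R) :
  transition_function P -> honest P -> markov_chain Pr X P ->
  (forall n, 0 < h n) -> h n @[n --> \oo] --> 0 -> 0 <= s ->
  wait (P (h n)) x (Num.trunc (s / h n)).+1 @[n --> \oo] -->
    1 - return_cdf Pr X x s.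
Proof.
move=> PP hP mc h0 hcvg s0; have [mX rc start _] := mc.
pose A := [set w | (return_time X x w <= s%:E)%E].
have mA : measurable A by exact: measurable_return_le.
pose W n := grid_wait X (h n) x (Num.trunc (s / h n)).+1 0.
have mW n : measurable (W n) by apply: measurable_grid_wait => //; exact: ltW.
have fcvg : {ae Pr x, forall w, setT w ->
    (fun n => (\1_(W n) w : R)%:E) @ \oo --> (\1_(~` A) w : R)%:E}.
  (* The exceptional null set consists of the paths not started at [x]; every other path is covered
     by [grid_wait_eventually]. *)
  exists (~` [set w | X 0 w = x]); split.
  - by apply: measurableC; exact: mX.
  - by rewrite probability_setC ?start ?subee//; exact: mX.
  move=> w /= H X0; apply: H => _; apply: cvg_near_cst.
  have := grid_wait_eventually (rc w) h0 hcvg s0 X0; apply: filterS => n Hn.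
  rewrite !indicE; have -> // : (w \in W n) = (w \in ~` A).
  by apply/idP/idP; rewrite !inE; case: Hn.
have fdom : {ae Pr x, forall w n, setT w ->
    (`|(\1_(W n) w : R)%:E| <= cst 1%E w)%E}.
  apply: aeW => w n _; rewrite abse_EFin lee_fin indicE.
  by case: (_ \in _); rewrite ?normr1// normr0.
have mi (B : set Omega) : measurable B -> measurable_fun setT (fun w => (\1_B w : R)%:E).
  by move=> mB; apply/measurable_EFinP; exact: measurable_indic.
have i1 : (Pr x).-integrable setT (cst 1%E).
  exact: finite_measure_integrable_cst.
have PrE (B : set Omega) : measurable B ->
    (\int[Pr x]_(w in setT) (\1_B w : R)%:E = Pr x B)%E.
  by move=> mB; rewrite integral_indic// setIT.
have [_ _] := dominated_convergence measurableT (fun n => mi _ (mW n))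
  (mi _ (measurableC mA)) fcvg i1 fdom.
rewrite (PrE _ (measurableC mA)).
have -> : Pr x (~` A) = (1 - return_cdf Pr X x s)%:E.
  by rewrite probability_setC// -(return_cdf_EFin _ _ mc) -EFinB.
move=> /fine_cvgP[_]; apply: cvg_trans; apply: near_eq_cvg.
apply: nearW => n /=; rewrite (PrE _ (mW n)) (prob_grid_wait0 _ _ mc)//.
  exact: ltW.
by apply: stochastic_transition => //; exact: ltW.
Qed.

(** * The Laplace transform identity *)

(** Squeeze between [a / (1 + a * h n)] and [a], both bounds coming from [1 + y <= expR y] at
    [y = a * h n] and [y = - a * h n]. *)
Lemma cvg_decay_quotient (R : realType) (a : R) (h : nat -> R) :
  0 < a -> (forall n, 0 < h n) -> h n @[n --> \oo] --> 0 ->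
  (1 - expR (- a * h n)) / h n @[n --> \oo] --> a.
Proof.
move=> a0 h0 hcvg.
have cl : a / (1 + a * h n) @[n --> \oo] --> a.
  rewrite -[X in _ --> X]divr1; apply: cvgM; first exact: cvg_cst.
  apply: cvgV; first exact: oner_neq0.
  rewrite -[X in _ --> X]addr0; apply: cvgD; first exact: cvg_cst.
  by rewrite -(mulr0 a); apply: cvgM => //; exact: cvg_cst.
apply: (squeeze_cvgr _ cl (cvg_cst a)); apply: nearW => n.
have hn := h0 n; have ah : 0 < 1 + a * h n by rewrite addr_gt0// mulr_gt0.
rewrite ler_pdivlMr// ler_pdivrMr// mulrAC.
have lo := expR_ge1Dx (- a * h n).
have up := expR_ge1Dx (a * h n).
have E : expR (- a * h n) * expR (a * h n) = 1.
  by rewrite -expRD mulNr addNr expR0.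
have z0 := expR_ge0 (- a * h n).
apply/andP; split; last by move: lo; rewrite mulNr; lra.
rewrite ler_pdivrMr// mulrBl mul1r.
have : expR (- a * h n) * (1 + a * h n) <= 1.
  by rewrite -[leRHS]E ler_wpM2l.
lra.
Qed.

(* With [u], [w] the return and waiting sequences of the skeleton of mesh [h]
   and [z = exp (- a h)], the identity [U W (1 - z) (1 - p z) = 1] becomes the
   claim when [h] tends to [0]. *)
Lemma green_laplace_return (R : realType) (d : measure_display)
    (Omega : measurableType d) (I : countType)
    (Pr : I -> probability Omega R) (X : R -> Omega -> I)
    (P : R -> I -> I -> R) (q : I -> I -> R) (x : I) (a : R) :
  transition_function P -> honest P -> standard P -> is_Qmatrix P q ->
  markov_chain Pr X P -> 0 < a ->
  a * green P a x * laplace_return Pr X a x * (a + exit_rate q x) = 1.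
Proof.
move=> PP hP sP qP mc a0.
pose h n : R := n.+1%:R^-1.
have h0 n : 0 < h n by exact: harmonic_gt0.
have hcvg : h n @[n --> \oo] --> 0 by exact: cvg_harmonic.
pose z n := expR (- a * h n); pose r n := (1 - z n) / a.
pose p n := P (h n) x x.
pose u n (k : nat) := P (k%:R * h n) x x.
pose w n k := wait (P (h n)) x k.
have sp n : stochastic (P (h n)) by apply: stochastic_transition => //; exact: ltW.
have z01 n : 0 <= z n < 1.
  by rewrite expR_ge0 expR_lt1 mulNr oppr_lt0 mulr_gt0.
have P01 s : 0 <= s -> 0 <= P s x x <= 1.
  by move=> s0; rewrite (transition_ge0 PP)//=; exact: transition_le1_point.
have fmod := standard_modulus x PP hP sP.
have u01 n k : 0 <= u n k <= 1 by apply: P01; rewrite mulr_ge0// ltW.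
have w01 n k : 0 <= w n k <= 1 by apply: (wait_ge0_le1 _ _ mc) => //; exact: ltW.
have Gcvg : r n * fine (gsum (z n) (u n)) @[n --> \oo] --> green P a x.
  apply: cvg_laplace_gsum => //; first exact: measurable_modulus.
  by move=> s s0; exact: (cvg_skeleton fmod h0 hcvg).
have Lcvg : r n * fine (gsum (z n) (fun k => w n k.+1)) @[n --> \oo] -->
    laplace_return Pr X a x.
  apply: (@cvg_laplace_gsum _ _ _ _ (fun n k => w n k.+1)) => //.
    (* Measurability of the tail, read off at an arbitrary window length. *)
    by have [] := return_tail_window_le x 0 mc ltr01.
  by move=> s s0; exact: cvg_wait.
have pcvg : p n @[n --> \oo] --> (1 : R).
  have := sP x x; rewrite eqxx => /cvg_at_rightP; apply; split => //.
have qcvg : (1 - p n) / h n @[n --> \oo] --> exit_rate q x.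
  have /cvg_at_rightP/(_ h) := qP x x.
  move=> /(_ (conj h0 hcvg)) /cvgN; apply: cvg_trans; apply: near_eq_cvg.
  by apply: nearW => n; rewrite /= eqxx -mulNr opprB.
have acvg := cvg_decay_quotient a0 h0 hcvg.
have zcvg : z n @[n --> \oo] --> (1 : R).
  have -> : z = fun n => 1 - (1 - z n) / h n * h n.
    by apply/funext => n; rewrite divfK ?gt_eqF// opprB addrC subrK.
  rewrite -[X in _ --> X]subr0; apply: cvgB; first exact: cvg_cst.
  by rewrite -(mulr0 a); exact: cvgM.
(* The renewal identity is arranged so that every factor converges: [1 - z] is [a * r], and
   [1 - p z] is distributed over [1 + z W']. Next to [W'] it is divided by [r], with [(1 - p z) / h]
   split as [(1 - p) / h + p (1 - z) / h], whose limit is [exit_rate q x + a]. *)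
have Ecvg : a * (r n * fine (gsum (z n) (u n))) *
    ((1 - p n * z n) + z n * (r n * fine (gsum (z n) (fun k => w n k.+1))) *
      (((1 - p n) / h n + p n * ((1 - z n) / h n)) / ((1 - z n) / h n / a)))
    @[n --> \oo] -->
    a * green P a x * ((1 - 1 * 1) + 1 * laplace_return Pr X a x *
      ((exit_rate q x + 1 * a) / (a / a))).
  apply: cvgM; first by apply: cvgM => //; exact: cvg_cst.
  apply: cvgD; first by apply: cvgB; [exact: cvg_cst|exact: cvgM].
  apply: cvgM; first exact: cvgM.
  apply: cvgM; first by apply: cvgD => //; exact: cvgM.
  apply: cvgV; first by rewrite divff ?oner_neq0 ?gt_eqF.
  by apply: cvgM => //; exact: cvg_cst.
have E n : a * (r n * fine (gsum (z n) (u n))) *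
    ((1 - p n * z n) + z n * (r n * fine (gsum (z n) (fun k => w n k.+1))) *
      (((1 - p n) / h n + p n * ((1 - z n) / h n)) / ((1 - z n) / h n / a))) = 1.
  have hn : 0 <= h n by exact: ltW.
  rewrite -[RHS](@renewal_gsum R (z n) (p n) (u n)
    (fun k => avoid (P (h n)) x k x) (w n) (z01 n))//; last 3 first.
  - by have /andP[] := P01 _ hn.
  - by move=> k; rewrite avoid_ge0 ?avoid_le1.
  - by move=> k; exact: (renewal k (sp n) (visits_skeleton x PP hn)).
  set U := fine _; set W := fine _; rewrite /r; field.
  have /andP[_ z1] := z01 n; rewrite !gt_eqF//= ?subr_gt0//.
have {}Ecvg : (1 : R) @[n --> \oo] --> a * green P a x * ((1 - 1 * 1) +
    1 * laplace_return Pr X a x * ((exit_rate q x + 1 * a) / (a / a))).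
  by apply: cvg_trans Ecvg; apply: near_eq_cvg; apply: nearW => n; rewrite E.
(* The arranged expression is 1 for every mesh, so its limit is 1 too. *)
rewrite [RHS](cvg_unique (@Rhausdorff R) (cvg_cst (1 : R)) Ecvg).
by field; rewrite gt_eqF.
Qed.

(** * The three estimates *)

Theorem proposition3p2 (R : realType) (d : measure_display)
    (Omega : measurableType d) (I : countType)
    (Pr : I -> probability Omega R) (X : R -> Omega -> I)
    (P : R -> I -> I -> R) (q : I -> I -> R)
    (P_transition : transition_function P)
    (P_honest : honest P) (P_standard : standard P)
    (q_Qmatrix : is_Qmatrix P q) (q_regular : regular_Qmatrix q)
    (X_chain : markov_chain Pr X P) (X_nonexplosive : nonexplosive Pr X)
    (x : I) :
  \forall t \near +oo_R,
    [/\ 1 - (expR 1)^-1 <= occupation P t x / green P t^-1 x <= expR 1,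
        1 - (expR 1)^-1
          <= truncated_return Pr X t x / laplace_return Pr X t^-1 x
          <= expR 1
      & (2 * exit_rate q x)^-1
          <= green P t^-1 x * laplace_return Pr X t^-1 x / t
          <= (exit_rate q x)^-1].
Proof.
have q0 : 0 < exit_rate q x := exit_rate_gt0 q_regular x.
near=> t.
have t0 : 0 < t by near: t; exact: nbhs_pinfty_gt.
(* This threshold serves the lower bound in (3), where [t^-1 <= exit_rate q x] is used. *)
have tq : (exit_rate q x)^-1 <= t by near: t; apply: nbhs_pinfty_ge; exact: num_real.
have a0 : 0 < t^-1 by rewrite invr_gt0.
have fmod := standard_modulus x P_transition P_honest P_standard.
have mP := measurable_modulus fmod.
have P01 s : 0 <= s -> 0 <= P s x x <= 1.
  move=> s0; rewrite (transition_ge0 P_transition)//=.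
  exact: transition_le1_point.
have F01 s : 0 <= s -> 0 <= 1 - return_cdf Pr X x s <= 1.
  move=> _; have /andP[] := return_cdf_ge0_le1 x s X_chain.
  by rewrite subr_ge0 gerBl => -> ->.
have G0 : 0 <= green P t^-1 x.
  apply: Rintegral_ge0 => s; rewrite /= in_itv/= andbT => s0.
  by rewrite mulr_ge0 ?expR_ge0//; case/andP: (P01 s s0).
have L0 : 0 <= laplace_return Pr X t^-1 x.
  apply: Rintegral_ge0 => s; rewrite /= in_itv/= andbT => s0.
  by rewrite mulr_ge0 ?expR_ge0//; case/andP: (F01 s s0).
have GL := green_laplace_return x P_transition P_honest P_standard q_Qmatrix
  X_chain a0.
(* Neither transform can vanish, as the product in [GL] is 1; this makes the quotients in (1) and
   (2) genuine. *)
have {}G0 : 0 < green P t^-1 x.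
  rewrite lt_neqAle G0 andbT eq_sym; apply/eqP => G0'.
  by move: GL; rewrite G0' mulr0 !mul0r => /esym/eqP; rewrite oner_eq0.
have {}L0 : 0 < laplace_return Pr X t^-1 x.
  rewrite lt_neqAle L0 andbT eq_sym; apply/eqP => L0'.
  by move: GL; rewrite L0' mulr0 mul0r => /esym/eqP; rewrite oner_eq0.
split.
- rewrite ler_pdivlMr// ler_pdivrMr//.
  apply: (laplace_window_bounds t0 mP P01) => m.
  have mt0 : 0 <= m%:R * t by rewrite mulr_ge0// ltW.
  apply: (Rintegral_window_le mt0 t0 mP P01 fmod) => h N h0.
  exact: skeleton_window_le.
- rewrite ler_pdivlMr// ler_pdivrMr//.
  have [mF _] := return_tail_window_le x 0 X_chain t0.
  apply: (laplace_window_bounds t0 mF F01) => m.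
  by have [] := return_tail_window_le x m X_chain t0.
(* By [GL] the middle term of (3) is the inverse of [t^-1 + exit_rate q x], a number between
   [exit_rate q x] and its double. *)
- have aq0 : 0 < t^-1 + exit_rate q x by rewrite addr_gt0.
  have -> : green P t^-1 x * laplace_return Pr X t^-1 x / t =
      (t^-1 + exit_rate q x)^-1.
    apply: (mulIf (lt0r_neq0 aq0)); rewrite mulVf ?lt0r_neq0//.
    by rewrite -[RHS]GL; ring.
  rewrite !lef_pV2 ?posrE ?mulr_gt0// lerDr (ltW a0) andbT.
  by rewrite mulrDl mul1r lerD2r -[leRHS]invrK lef_pV2 ?posrE ?invr_gt0.
Unshelve. all: by end_near. Qed.
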